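(* Let $(M,g)$ be an $(n+1)$-dimensional Riemannian manifold and let $\xi$ be a unit vector field on $M$, regarded as a map $\xi:M\to T_1M$ into the unit tangent sphere bundle with the Sasaki metric. At a point $Q\in M$ let $\{e_0,e_1,\dots,e_n\}$ be an orthonormal frame of $T_QM$ and $\{f_1,\dots,f_n\}$ an orthonormal frame of $\xi_Q^\perp$ such that, for $\alpha=1,\dots,n$, $$(\nabla\xi)(e_0)=0,\qquad (\nabla\xi)(e_\alpha)=\lambda_\alpha f_\alpha,\qquad (\nabla\xi)^*(f_\alpha)=\lambda_\alpha e_\alpha ,$$ where $\lambda_1,\dots,\lambda_n\ge 0$ are the singular values of $\nabla\xi$ at $Q$. Let $H_{\sigma|}$ ($\sigma=1,\dots,n$) be the components of the mean curvature vector of the submanifold $\xi(M)\subset T_1M$ at $\xi(Q)$ with respect to the orthonormal normal frame $$\tilde n_\sigma=\frac{1}{\sqrt{1+\lambda_\sigma^2}}\left(-\lambda_\sigma e_\sigma^H+f_\sigma^V\right),\qquad \sigma=1,\dots,n .$$ Then $$(n+1)H_{\sigma|}=\frac{1}{\sqrt{1+\lambda_\sigma^2}}\left\{\langle r(e_0,e_0)\xi,f_\sigma\rangle+\sum_{\alpha=1}^n\frac{\langle r(e_\alpha,e_\alpha)\xi,f_\sigma\rangle+\lambda_\sigma\lambda_\alpha\langle R(e_\sigma,e_\alpha)\xi,f_\alpha\rangle}{1+\lambda_\alpha^2}\right\}.$$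
   Context: $\nabla$ is the Levi-Civita connection of $g$, and $\langle\cdot,\cdot\rangle=g$. For a unit vector field $\xi$, $(\nabla\xi)(X)=\nabla_X\xi$ defines at each point $Q$ a linear operator $T_QM\to\xi_Q^\perp$ ($\xi^\perp_Q$ is the orthogonal complement of $\xi$ in $T_QM$); its adjoint $(\nabla\xi)^*:\xi_Q^\perp\to T_QM$ is defined by $\langle(\nabla\xi)^*X,Y\rangle=\langle X,\nabla_Y\xi\rangle$. Put $r(X,Y)\xi=\nabla_X\nabla_Y\xi-\nabla_{\nabla_XY}\xi$ (tensorial in $X,Y$), and $R(X,Y)\xi=r(X,Y)\xi-r(Y,X)\xi$, i.e. $R(X,Y)=\nabla_X\nabla_Y-\nabla_Y\nabla_X-\nabla_{[X,Y]}$ is the Riemann curvature tensor. Let $\pi:TM\to M$ be the projection and let $K:T_{(Q,\xi)}TM\to T_QM$ be the connection map, in induced coordinates $(u^i,\xi^i)$ given by $K\big(A^i\partial_{u^i}+B^i\partial_{\xi^i}\big)=(B^i+\Gamma^i_{jk}\xi^jA^k)\partial_{u^i}$. The Sasaki metric on $TM$ is $\langle\langle\tilde X,\tilde Y\rangle\rangle=\langle\pi_*\tilde X,\pi_*\tilde Y\rangle+\langle K\tilde X,K\tilde Y\rangle$; $T_1M=\{(Q,\xi):|\xi|=1\}$ carries the induced metric. For $X\in T_QM$, the horizontal lift $X^H$ and the vertical lift $X^V$ in $T_{(Q,\xi)}TM$ are determined by $\pi_*X^H=X,\ KX^H=0$ and $\pi_*X^V=0,\ KX^V=X$. All lifts are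 taken at the point $(Q,\xi(Q))$ of $\xi(M)$. For a normal vector $\tilde N$ to $\xi(M)$ in $T_1M$, the second fundamental form is $\tilde\Omega_{\tilde N}(\tilde X,\tilde Y)=\langle\langle\tilde\nabla_{\tilde X}\tilde Y,\tilde N\rangle\rangle$, where $\tilde\nabla$ is the Levi-Civita connection of $T_1M$. The component $H_{\sigma|}$ of the mean curvature vector is $\frac{1}{n+1}$ times the trace of $\tilde\Omega_{\tilde n_\sigma}$ with respect to the induced metric on $\xi(M)$. *)

(* Defs.v *)
From HB Require Import structures.
From mathcomp Require Import all_boot all_order all_algebra.
From mathcomp Require Import all_classical all_reals all_analysis.

Set Implicit Arguments.
Unset Strict Implicit.
Unset Printing Implicit Defensive.

Import Order.TTheory GRing.Theory Num.Theory.
Import numFieldNormedType.Exports.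

Local Open Scope classical_set_scope.
Local Open Scope ring_scope.

(* Tangent vectors are row vectors of components, so that the library's
   Jacobian acts on the right: 'D_v F x = v *m 'J F x.  *)

Definition bvec (R : realType) (m : nat) (i : 'I_m) : 'rV[R]_m := delta_mx 0 i.

Section Smooth.
Variables (R : realType) (m : nat) (V : normedModType R).

Fixpoint Ck_on (k : nat) (O : set 'rV[R]_m) (F : 'rV[R]_m -> V) : Prop :=
  (forall x, O x -> {for x, continuous F}) /\
  if k is k'.+1 then
    forall i : 'I_m, (forall x, O x -> derivable F x (bvec R i)) /\
                     Ck_on k' O ('D_(bvec R i) F)
  else True.

Definition smooth_on (O : set 'rV[R]_m) (F : 'rV[R]_m -> V) : Prop :=
  forall k, Ck_on k O F.

End Smooth.

(* A smooth manifold modelled on R^m; [point_at c] is the inverse of the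
   coordinate map [coords c] on the chart domain [dom c].  The family of charts
   need not be maximal, but may be. *)
Record manifold (R : realType) (m : nat) := Manifold {
  points :> topologicalType;
  chart : Type;
  dom : chart -> set points;
  coords : chart -> points -> 'rV[R]_m;
  point_at : chart -> 'rV[R]_m -> points;
  points_hausdorff : hausdorff_space points;
  points_second_countable : @second_countable points;
  dom_open : forall c, open (dom c);
  dom_cover : forall p : points, exists c, dom c p;
  img_open : forall c, open (coords c @` dom c);
  coordsK : forall c p, dom c p -> point_at c (coords c p) = p;
  coords_continuous : forall c p, dom c p -> {for p, continuous (coords c)};
  point_at_continuous : forall c u, (coords c @` dom c) u ->
    {for u, continuous (point_at c)};
  transition_smooth : forall c d,
    smooth_on [set u | (coords c @` dom c) u /\ dom d (point_at c u)]
              (fun u => coords d (point_at c u))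
}.

Section ManifoldCharts.
Variables (R : realType) (m : nat) (M : manifold R m).
Implicit Types c d : chart M.

Definition img c : set 'rV[R]_m := coords c @` dom c.

Definition overlap c d : set 'rV[R]_m :=
  [set u | img c u /\ dom d (point_at c u)].

Definition transition c d (u : 'rV[R]_m) : 'rV[R]_m := coords d (point_at c u).

End ManifoldCharts.

Definition inprod (R : realType) (m : nat) (G : 'M[R]_m) (X Y : 'rV[R]_m) : R :=
  (X *m G *m Y^T) 0 0.

Definition orthonormal_frame (R : realType) (m k : nat) (G : 'M[R]_m)
    (b : 'I_k -> 'rV[R]_m) : Prop :=
  forall i j, inprod G (b i) (b j) = (i == j)%:R.

(* [gram c u] is the matrix (g_ij) of the metric at the point of coordinates u
   in the chart c. *)
Record riemannian (R : realType) (m : nat) := Riemannian {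
  underlying :> manifold R m;
  gram : chart underlying -> 'rV[R]_m -> 'M[R]_m;
  gram_smooth : forall c, smooth_on (img c) (gram c);
  gram_sym : forall c u, img c u -> (gram c u)^T = gram c u;
  gram_pos : forall c u (X : 'rV[R]_m), img c u -> X != 0 ->
    0 < inprod (gram c u) X X;
  gram_compat : forall c d u, overlap c d u ->
    gram c u = 'J (transition c d) u *m gram d (transition c d u)
               *m ('J (transition c d) u)^T
}.

(* [field c u] is the row of components, in the chart c, of the vector field at
   the point of coordinates u. *)
Record unit_field (R : realType) (m : nat) (M : riemannian R m) := UnitField {
  field :> chart M -> 'rV[R]_m -> 'rV[R]_m;
  field_smooth : forall c, smooth_on (img c) (field c);
  field_compat : forall c d u, overlap c d u ->
    field d (transition c d u) = field c u *m 'J (transition c d) u;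
  field_unit : forall c u, img c u -> inprod (gram c u) (field c u) (field c u) = 1
}.

(* The Levi-Civita connection of a metric u |-> G u on an open set of R^m. *)
Section LeviCivita.
Variables (R : realType) (m : nat) (G : 'rV[R]_m -> 'M[R]_m).

Definition dgram (j l k : 'I_m) (u : 'rV[R]_m) : R :=
  'D_(bvec R j) (fun v => G v l k : R) u.

(* Gamma^i_{jk} *)
Definition christoffel (u : 'rV[R]_m) (i j k : 'I_m) : R :=
  2^-1 * \sum_l invmx (G u) i l *
           (dgram j l k u + dgram k l j u - dgram l j k u).

Definition Gamma (u X Y : 'rV[R]_m) : 'rV[R]_m :=
  \row_i \sum_j \sum_k christoffel u i j k * X 0 j * Y 0 k.

(* nabla_X Z *)
Definition covd (X Z : 'rV[R]_m -> 'rV[R]_m) (u : 'rV[R]_m) : 'rV[R]_m :=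
  'D_(X u) Z u + Gamma u (X u) (Z u).

(* The covariant derivative, in the direction x at u, of a field Y along a map F
   (Y u is a tangent vector at F u). *)
Definition covd_along (p : nat) (F : 'rV[R]_p -> 'rV[R]_m) (x : 'rV[R]_p)
    (Y : 'rV[R]_p -> 'rV[R]_m) (u : 'rV[R]_p) : 'rV[R]_m :=
  'D_x Y u + Gamma (F u) ('D_x F u) (Y u).

Definition second_covd (X Y Z : 'rV[R]_m -> 'rV[R]_m) (u : 'rV[R]_m) :
    'rV[R]_m :=
  covd X (covd Y Z) u - covd (covd X Y) Z u.

(* The next three are tensorial in the tangent vectors x, y at u, which are
   extended to fields with constant components. *)
Definition nabla (Z : 'rV[R]_m -> 'rV[R]_m) (u x : 'rV[R]_m) : 'rV[R]_m :=
  covd (cst x) Z u.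

Definition rten (Z : 'rV[R]_m -> 'rV[R]_m) (u x y : 'rV[R]_m) : 'rV[R]_m :=
  second_covd (cst x) (cst y) Z u.

Definition Riem (Z : 'rV[R]_m -> 'rV[R]_m) (u x y : 'rV[R]_m) : 'rV[R]_m :=
  rten Z u x y - rten Z u y x.

End LeviCivita.

(* The Sasaki metric in the coordinates z = row_mx u v of TM induced by a chart:
   u is the base point and v the row of fibre coordinates. *)
Section Sasaki.
Variables (R : realType) (m : nat) (G : 'rV[R]_m -> 'M[R]_m).
Implicit Types z w : 'rV[R]_(m + m).

Definition conn_map z w : 'rV[R]_m :=
  rsubmx w + Gamma G (lsubmx z) (rsubmx z) (lsubmx w).

Definition sasaki z w w' : R :=
  inprod (G (lsubmx z)) (lsubmx w) (lsubmx w') +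
  inprod (G (lsubmx z)) (conn_map z w) (conn_map z w').

Definition hlift z (X : 'rV[R]_m) : 'rV[R]_(m + m) :=
  row_mx X (- Gamma G (lsubmx z) (rsubmx z) X).

Definition vlift z (X : 'rV[R]_m) : 'rV[R]_(m + m) := row_mx 0 X.

Lemma hliftE z X : lsubmx (hlift z X) = X /\ conn_map z (hlift z X) = 0.
Proof. by rewrite /conn_map row_mxKl row_mxKr addNr. Qed.

Lemma vliftE z X : lsubmx (vlift z X) = 0 /\ conn_map z (vlift z X) = X.
Proof.
rewrite /conn_map row_mxKl row_mxKr; split=> //.
suff -> : Gamma G (lsubmx z) (rsubmx z) 0 = 0 by rewrite addr0.
apply/rowP => i; rewrite [LHS]mxE [RHS]mxE big1 // => j _.
by rewrite big1 // => k _; rewrite [X in _ * X]mxE mulr0.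
Qed.

End Sasaki.

Section UnitTangentBundle.
Variables (R : realType) (n : nat) (M : riemannian R n.+1).

Definition unit_tangent (c : chart M) : set 'rV[R]_(n.+1 + n.+1) :=
  [set z | img c (lsubmx z) /\
           inprod (gram c (lsubmx z)) (rsubmx z) (rsubmx z) = 1].

(* A local chart of the embedded hypersurface T_1M of TM, inside the induced
   chart of TM over c: [utc_par] is a diffeomorphism of an open set of R^(2n+1)
   onto the trace on T_1M of an open set [utc_dom] of TM, and its inverse is the
   restriction of the smooth map [utc_coords]. *)
Record unit_tangent_chart (c : chart M) := UnitTangentChart {
  utc_dom : set 'rV[R]_(n.+1 + n.+1);
  utc_img : set 'rV[R]_(n.+1 + n);
  utc_coords : 'rV[R]_(n.+1 + n.+1) -> 'rV[R]_(n.+1 + n);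
  utc_par : 'rV[R]_(n.+1 + n) -> 'rV[R]_(n.+1 + n.+1);
  utc_dom_open : open utc_dom;
  utc_dom_sub : forall z, utc_dom z -> img c (lsubmx z);
  utc_img_open : open utc_img;
  utc_coords_smooth : smooth_on utc_dom utc_coords;
  utc_par_smooth : smooth_on utc_img utc_par;
  utc_par_dom : forall w, utc_img w ->
    (utc_dom `&` unit_tangent c) (utc_par w);
  utc_coords_img : forall z, (utc_dom `&` unit_tangent c) z ->
    utc_img (utc_coords z);
  utc_parK : forall w, utc_img w -> utc_coords (utc_par w) = w;
  utc_coordsK : forall z, (utc_dom `&` unit_tangent c) z ->
    utc_par (utc_coords z) = z
}.

Section SecondForm.
Variables (xi : unit_field M) (c : chart M) (t : unit_tangent_chart c).

(* The metric of T_1M induced by the Sasaki metric, in the coordinates t. *)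
Definition ut_gram (w : 'rV[R]_(n.+1 + n)) : 'M[R]_(n.+1 + n) :=
  \matrix_(i, j) sasaki (gram c) (utc_par t w)
                   ('D_(bvec R i) (utc_par t) w) ('D_(bvec R j) (utc_par t) w).

(* The point (Q, xi(Q)) of TM, where Q has coordinates u. *)
Definition lift_pt (u : 'rV[R]_n.+1) : 'rV[R]_(n.+1 + n.+1) :=
  row_mx u (xi c u).

(* The map xi : M -> T_1M in the coordinates c and t. *)
Definition ut_map (u : 'rV[R]_n.+1) : 'rV[R]_(n.+1 + n) :=
  utc_coords t (lift_pt u).

(* The metric of xi(M) induced by that of T_1M, in the coordinates c. *)
Definition sub_gram (u : 'rV[R]_n.+1) : 'M[R]_n.+1 :=
  \matrix_(i, j) inprod (ut_gram (ut_map u))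
                   ('D_(bvec R i) ut_map u) ('D_(bvec R j) ut_map u).

(* The second fundamental form of xi(M) in T_1M on the vectors xi_* x, xi_* y
   (xi_* y being extended along xi(M) with constant y), for the normal vector N,
   given by its components in TM: the Levi-Civita derivative of T_1M is pushed
   into TM by the differential of utc_par t. *)
Definition second_form (u : 'rV[R]_n.+1) (N : 'rV[R]_(n.+1 + n.+1))
    (x y : 'rV[R]_n.+1) : R :=
  sasaki (gram c) (lift_pt u)
    ('D_(covd_along ut_gram ut_map x (fun v => 'D_y ut_map v) u)
        (utc_par t) (ut_map u))
    N.

Definition mean_curv (u : 'rV[R]_n.+1) (N : 'rV[R]_(n.+1 + n.+1)) : R :=
  (n.+1%:R)^-1 *
  \tr (invmx (sub_gram u) *m
       \matrix_(i, j) second_form u N (bvec R i) (bvec R j)).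

End SecondForm.

End UnitTangentBundle.

(* Main.v *)
(* In a chart t of T_1M write P for its parametrization, L(v) = (v, xi(v)) and
   S for the matrix of the Sasaki metric of TM.  The induced metric of T_1M is
   the pullback of S by P, so expanding its Christoffel symbols of the first
   kind and the second derivative of P o ut_map = L eliminates t: for a normal
   N, with a = D_x L,
     II_N(x, x) = S(D_x D_x L, N) + (D_a S)(a, N) - (D_N S)(a, a) / 2.
   This requires N to be tangent to the image of P, which holds because that
   tangent space has dimension 2n+1, as does the kernel of c |-> g(K c, xi),
   in which it is contained.  Since
   (D_c K) a - (D_a K) c, taken covariantly, is R(c, a) xi, and N is orthogonal
   to the vectors D_y L, the right-hand side is
     g(r(x, x) xi, K N) + g(nabla_x xi, R(x, pi_* N) xi).
   The frame e is orthogonal for the induced metric of xi(M), with squared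
   lengths 1 and 1 + lambda_alpha^2, which gives the trace. *)

Require Import Defs.
From HB Require Import structures.
From mathcomp Require Import all_boot all_order all_algebra.
From mathcomp Require Import all_classical all_reals all_analysis.
From mathcomp Require Import ring lra perm.
Import Order.TTheory GRing.Theory Num.Theory.
Import numFieldNormedType.Exports.
Local Open Scope classical_set_scope.
Local Open Scope ring_scope.

Set Implicit Arguments.
Unset Strict Implicit.
Unset Printing Implicit Defensive.

(** * Differentiation of matrix-valued maps *)

(** Two facts about second derivatives shape the argument. The Koszul formula of the pullback metric
    produces the second derivative of P in the direction of ['D_x F], with F = [ut_map]; this is
    exactly the term by which the second derivative of L = P o F differs from the pushed forward
    second derivative of F, so the sum no longer depends on t. The coordinate computation also
    leaves a non-covariant vector Gamma(x, x); it enters only through the Sasaki product of N with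
    the derivative of L along Gamma(x, x), and this vanishes because N is normal. Symmetry of second
    derivatives is used twice: for P, to cancel terms in the Koszul formula, and for xi, to identify
    the antisymmetrized r with the curvature. Since [smooth_on] speaks only of partial derivatives
    along the basis, this symmetry and Fréchet differentiability are derived from it. All formulas
    hold on open sets only, hence the many statements with [\near]. *)

Section Calculus.
Context {R : realType}.
Implicit Types V W : normedModType R.

Lemma differentiable_mx V p q (F : V -> 'M[R]_(p, q)) x :
  (forall i j, differentiable (fun y => F y i j) x) -> differentiable F x.
Proof.
move=> dF.
have -> : F = \sum_(i < p) \sum_(j < q) (fun y => F y i j *: delta_mx i j).
  apply/funext => y; rewrite {1}(matrix_sum_delta (F y)) fct_sumE.
  by apply: eq_bigr => i _; rewrite fct_sumE.
apply: differentiable_sum => i; apply: differentiable_sum => j.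
exact: differentiableZl.
Qed.

Lemma differentiable_entry V p q (F : V -> 'M[R]_(p, q)) x i j :
  differentiable F x -> differentiable (fun y => F y i j) x.
Proof.
move=> dF; apply: (@differentiable_comp _ _ _ _ F (fun N => N i j : R)) => //.
exact: differentiable_coord.
Qed.

Lemma derive_entry V p q (F : V -> 'M[R]_(p, q)) x v i j :
  derivable F x v -> ('D_v F x) i j = 'D_v (fun y => F y i j) x.
Proof. by move=> dF; rewrite derive_mx// mxE. Qed.

(** Formulas for derivatives hold only on an open domain, so differentiability has to pass between
    maps that agree merely near the point; the little-o expansion at [x] sees nothing else. *)
Lemma differentiable_near_eq V W (f g : V -> W) x :
  (\near x, f x = g x) -> differentiable f x -> differentiable g x.
Proof.
move=> fg /diff_locallyP [cdf df].
have fgx := nbhs_singleton fg.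
have e : g \o shift x = cst (g x) + 'd f x +o_ 0 id.
  apply/eqaddoP => eps e0.
  move/eqaddoP : df => /(_ eps e0); apply: filter_app.
  move/nbhs0P : fg; apply: filter_app; apply: filterE => h /=.
  by rewrite !fctE /= fgx [h + x]addrC => ->.
have h := diff_unique cdf e.
by apply/diff_locallyP; rewrite h.
Qed.

Lemma derive_chain V W (U : normedModType R) (f : U -> V) (g : V -> W) x v :
  differentiable f x -> differentiable g (f x) ->
  'D_v (fun y => g (f y)) x = 'D_('D_v f x) g (f x).
Proof.
move=> df dg; rewrite -[fun _ => _]/(g \o f) deriveE; last exact: differentiable_comp.
by rewrite diff_comp //= !deriveE.
Qed.

Lemma derive_linear V W (f : V -> W) x a v w :
  differentiable f x -> 'D_(a *: v + w) f x = a *: 'D_v f x + 'D_w f x.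
Proof. by move=> df; rewrite !deriveE // linearP. Qed.

Lemma derive_sum_dir V W (f : V -> W) x k (a : 'I_k -> R) (v : 'I_k -> V) :
  differentiable f x -> 'D_(\sum_i a i *: v i) f x = \sum_i a i *: 'D_(v i) f x.
Proof.
move=> df; rewrite deriveE// linear_sum; apply: eq_bigr => i _.
by rewrite linearZ deriveE.
Qed.

Lemma row_sum_bvec m (v : 'rV[R]_m) : v = \sum_i v 0 i *: bvec R i.
Proof. exact: row_sum_delta. Qed.

Lemma differentiable_mulmx V p q r (A : V -> 'M[R]_(p, q)) (B : V -> 'M[R]_(q, r)) x :
  differentiable A x -> differentiable B x -> differentiable (fun y => A y *m B y) x.
Proof.
move=> dA dB; apply: differentiable_mx => i j.
have -> : (fun y => (A y *m B y) i j) =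
   \sum_k ((fun y => A y i k) * (fun y => B y k j)).
  by apply/funext => y; rewrite mxE fct_sumE.
by apply: differentiable_sum => k; apply: differentiableM; exact: differentiable_entry.
Qed.

Lemma derive_mulmx V p q r (A : V -> 'M[R]_(p, q)) (B : V -> 'M[R]_(q, r)) x v :
  differentiable A x -> differentiable B x ->
  'D_v (fun y => A y *m B y) x = 'D_v A x *m B x + A x *m 'D_v B x.
Proof.
move=> dA dB; apply/matrixP => i j.
rewrite derive_entry; last exact/diff_derivable/differentiable_mulmx.
have -> : (fun y => (A y *m B y) i j) =
   \sum_k ((fun y => A y i k) * (fun y => B y k j)).
  by apply/funext => y; rewrite mxE fct_sumE.
have dAe k : derivable (fun y => A y i k) x v.
  exact/diff_derivable/differentiable_entry.
have dBe k : derivable (fun y => B y k j) x v.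
  exact/diff_derivable/differentiable_entry.
rewrite derive_sum; last by move=> k; exact: derivableM.
rewrite !mxE -big_split; apply: eq_bigr => k _ /=.
rewrite deriveM// !derive_entry; try exact/diff_derivable.
by rewrite addrC; congr (_ + _); exact: mulrC.
Qed.

Lemma differentiable_trmx V p q (A : V -> 'M[R]_(p, q)) x :
  differentiable A x -> differentiable (fun y => (A y)^T) x.
Proof.
move=> dA; apply: differentiable_mx => i j.
have -> : (fun y => (A y)^T i j) = (fun y => A y j i) by apply/funext => y; rewrite mxE.
exact: differentiable_entry.
Qed.

Lemma derive_trmx V p q (A : V -> 'M[R]_(p, q)) x v :
  differentiable A x -> 'D_v (fun y => (A y)^T) x = ('D_v A x)^T.
Proof.
move=> dA; apply/matrixP => i j.
rewrite derive_entry; last exact/diff_derivable/differentiable_trmx.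
rewrite mxE derive_entry; last exact/diff_derivable.
by congr ('D_v _ x); apply/funext => y; rewrite mxE.
Qed.

Lemma differentiable_inprod V m (A : V -> 'M[R]_m) (X Y : V -> 'rV[R]_m) x :
  differentiable A x -> differentiable X x -> differentiable Y x ->
  differentiable (fun y => inprod (A y) (X y) (Y y)) x.
Proof.
move=> dA dX dY; apply: (@differentiable_entry _ 1 1).
apply: differentiable_mulmx; first exact: differentiable_mulmx.
exact: differentiable_trmx.
Qed.

Lemma derive_inprod V m (A : V -> 'M[R]_m) (X Y : V -> 'rV[R]_m) x v :
  differentiable A x -> differentiable X x -> differentiable Y x ->
  'D_v (fun y => inprod (A y) (X y) (Y y)) x =
  inprod ('D_v A x) (X x) (Y x) + inprod (A x) ('D_v X x) (Y x)
  + inprod (A x) (X x) ('D_v Y x).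
Proof.
move=> dA dX dY; rewrite /inprod.
have dXA : differentiable (fun y => X y *m A y) x by exact: differentiable_mulmx.
have dYT := differentiable_trmx dY.
rewrite -(@derive_entry _ 1 1); last exact/diff_derivable/differentiable_mulmx.
rewrite derive_mulmx// derive_mulmx// derive_trmx// mulmxDl !mxE.
by congr (_ + _); rewrite [LHS]addrC.
Qed.

End Calculus.

(** * Continuous partial derivatives and symmetry of second derivatives *)

Section MeanValue.
Context {R : realType}.

Lemma is_derive_line (V : normedModType R) (f : V -> R) x v (s : R) :
  derivable f (x + s *: v) v ->
  is_derive s (1 : R) (fun r : R => f (x + r *: v)) ('D_v f (x + s *: v)).
Proof.
move=> df.
have E : (fun h : R => h^-1 *: (((fun r => f (x + r *: v)) \o shift s) (h *: 1)
            - f (x + s *: v))) =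
  (fun h => h^-1 *: ((f \o shift (x + s *: v)) (h *: v) - f (x + s *: v))).
  apply/funext => h /=; congr (_ *: (f _ - _)).
  by rewrite scalerDl [h *: 1]mulr1 addrCA.
by apply: DeriveDef; rewrite /derivable /derive /= E.
Qed.

Lemma MVT_line_ge0 (V : normedModType R) (f : V -> R) x v (a : R) : 0 <= a ->
  (forall s, 0 <= s <= 1 -> derivable f (x + (s * a) *: v) v) ->
  exists2 s, 0 <= s <= 1 & f (x + a *: v) - f x = a * 'D_v f (x + (s * a) *: v).
Proof.
rewrite le_eqVlt => /orP[/eqP <- _|a0 df].
  by exists 0; rewrite ?lexx ?ler01 // scale0r addr0 subrr mul0r.
have sa r : 0 <= r <= a -> 0 <= r / a <= 1.
  by move=> /andP[r0 ra]; rewrite divr_ge0 ?(ltW a0)// ler_pdivrMr// mul1r.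
have dfr r : 0 <= r <= a -> derivable f (x + r *: v) v.
  by move=> /sa /df; rewrite divfK// gt_eqF.
have [||c] := @MVT_segment R (fun r => f (x + r *: v))
                (fun r => 'D_v f (x + r *: v)) 0 a (ltW a0).
- move=> r; rewrite in_itv /= => /andP[r0 ra].
  by apply: is_derive_line; apply: dfr; rewrite !ltW.
- apply/continuous_in_subspaceT => r; rewrite inE /= in_itv /= => r0a.
  apply: differentiable_continuous; apply/derivable1_diffP.
  by have [] := is_derive_line (dfr r r0a).
rewrite in_itv /= => c0a; rewrite scale0r addr0 subr0 => E.
by exists (c / a); [exact: sa|rewrite E divfK ?gt_eqF// mulrC].
Qed.

Lemma MVT_line (V : normedModType R) (f : V -> R) x v (a : R) :
  (forall s, 0 <= s <= 1 -> derivable f (x + (s * a) *: v) v) ->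
  exists2 s, 0 <= s <= 1 & f (x + a *: v) - f x = a * 'D_v f (x + (s * a) *: v).
Proof.
have [a0 df|a0 df] := leP 0 a; first exact: MVT_line_ge0.
have E s : x + a *: v + (s * - a) *: v = x + ((1 - s) * a) *: v.
  by rewrite -addrA -scalerDl mulrBl mul1r mulrN.
(* For a negative increment the segment is traversed from its other end point, which replaces the
   parameter [s] by [1 - s]. *)
have [||s s01 H] := @MVT_line_ge0 V f (x + a *: v) v (- a).
- by rewrite oppr_ge0 ltW.
- by move=> s s01; rewrite E; apply: df; lra.
exists (1 - s); first by lra.
move: H; rewrite E -addrA -scalerDl subrr scale0r addr0 => H.
by rewrite -opprB H mulNr opprK.
Qed.

(** The increment is split into moves along one coordinate at a time; the mean value theorem turns
    each move into a partial derivative at a nearby point, close to the one at [x] by continuity. *)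
Lemma differentiable_partials m (f : 'rV[R]_m -> R) x :
  (\forall y \near x, forall i, derivable f y (bvec R i)) ->
  (forall i, {for x, continuous ('D_(bvec R i) f)}) ->
  differentiable f x.
Proof.
move=> df cf.
pose L (h : 'rV[R]_m) : R := \sum_i h 0 i * 'D_(bvec R i) f x.
have Llin : linear L.
  move=> a h k; rewrite /L scaler_sumr -big_split; apply: eq_bigr => i _ /=.
  by rewrite !mxE mulrDl -mulrA.
pose LL : {linear 'rV[R]_m -> R} := HB.pack L (GRing.isLinear.Build _ _ _ _ _ Llin).
have Lc : continuous LL.
  have -> : (LL : 'rV[R]_m -> R) =
      \sum_i (fun h : 'rV[R]_m => (h 0 i : R) * 'D_(bvec R i) f x).
    by apply/funext => h; rewrite fct_sumE.
  move=> h; apply: differentiable_continuous.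
  apply: differentiable_sum => i.
  apply: differentiableM => //; exact: differentiable_coord.
suff e : f \o shift x = cst (f x) + LL +o_ 0 id.
  have h := diff_unique Lc e.
  by apply/diff_locallyP; rewrite h.
apply/eqaddoP => eps e0.
(* Each of the [m] coordinate moves costs at most [e] times the norm of the increment; the divisor
   [m.+1] is nonzero even for [m = 0]. *)
pose e := eps / m.+1%:R.
have ep : 0 < e by rewrite divr_gt0.
have : \forall y \near x, forall i, derivable f y (bvec R i) /\
    `|'D_(bvec R i) f y - 'D_(bvec R i) f x| <= e.
  pose P i y := derivable f y (bvec R i) /\
    `|'D_(bvec R i) f y - 'D_(bvec R i) f x| <= e.
  apply: (@filter_forall _ _ P _ (nbhs_filter x)) => i; near=> y; split.
    by near: y; apply: filterS df => z; apply.
  rewrite distrC; near: y; move/cvgrPdist_le: (cf i); exact.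
case/nbhs_ballP => d /= d0 Hd.
apply/nbhs_ballP; exists d => //= h; rewrite -ball_normE /= sub0r normrN => hd.
(* [tr k] keeps the first [k] coordinates of [h]; in the sup norm every intermediate point is no
   farther from [x] than [x + h]. *)
pose tr k : 'rV[R]_m := \row_i (if (i < k)%N then h 0 i else 0).
have hle i : `|h 0 i| <= `|h|.
  by rewrite [leRHS]/Num.Def.normr /= mx_normrE; exact: (le_bigmax _ _ (0, i)).
have step k : (k <= m)%N ->
   `|f (x + tr k) - f x - \sum_(i < m | (i < k)%N) h 0 i * 'D_(bvec R i) f x|
     <= k%:R * e * `|h|.
  elim: k => [_|k IH km].
    rewrite big_pred0// subr0.
    have -> : tr 0%N = 0 by apply/rowP => i; rewrite !mxE.
    by rewrite addr0 subrr normr0 !mul0r.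
  pose kk := Ordinal km.
  have trS : tr k.+1 = tr k + h 0 kk *: bvec R kk.
    apply/rowP => i; rewrite !mxE eqxx /= ltnS leq_eqVlt -val_eqE /=.
    case: ltngtP => //= ik; rewrite ?mulr0 ?mulr1 ?addr0 ?add0r//.
    by congr (h 0 _); exact: val_inj.
  have inb s : 0 <= s <= 1 -> ball x d (x + tr k + (s * h 0 kk) *: bvec R kk).
    move=> s01; rewrite -ball_normE /= -!addrA opprD addrA subrr add0r normrN.
    apply: le_lt_trans hd.
    rewrite [leLHS]/Num.Def.normr /= mx_normrE; apply: bigmax_le => // -[i j] _ /=.
    rewrite ord1 !mxE eqxx /= -val_eqE /=.
    case: ltngtP => //= ik; rewrite ?mulr0 ?mulr1 ?addr0 ?add0r//.
      by rewrite normr0.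
    rewrite normrM ger0_norm; last by case/andP: s01.
    by rewrite (le_trans _ (hle kk))// ler_piMl //; case/andP: s01.
  have [s s01 E] := @MVT_line _ f (x + tr k) (bvec R kk) (h 0 kk)
     (fun s s01 => (Hd _ (inb s s01) kk).1).
  have [_ B] := Hd _ (inb s s01) kk.
  rewrite (bigD1 kk) /=; last exact: ltnSn.
  rewrite (eq_bigl (fun i : 'I_m => (i < k)%N)); last first.
    by move=> i; rewrite ltnS -val_eqE /= [RHS]ltn_neqAle andbC.
  rewrite trS addrA.
  set S := \sum_(_ < _ | _) _ in IH *.
  have -> : f (x + tr k + h 0 kk *: bvec R kk) - f x -
      (h 0 kk * 'D_(bvec R kk) f x + S) =
      (f (x + tr k) - f x - S) + h 0 kk *
       ('D_(bvec R kk) f (x + tr k + (s * h 0 kk) *: bvec R kk) - 'D_(bvec R kk) f x).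
    by rewrite mulrBr -E; ring.
  apply: le_trans (ler_normD _ _) _.
  rewrite mulrS [1 + _]addrC !mulrDl; apply: lerD; first exact/IH/ltnW.
  by rewrite normrM mul1r mulrC ler_pM.
have := step m (leqnn m).
have -> : tr m = h by apply/rowP => i; rewrite mxE ltn_ord.
rewrite (eq_bigl xpredT); last by move=> i; rewrite ltn_ord.
rewrite !fctE /= [h + x]addrC opprD addrA => /le_trans; apply.
apply: ler_wpM2r => //.
rewrite /e mulrCA ler_piMr ?(ltW e0)// ler_pdivrMr // mul1r ler_nat.
exact: leqnSn.
Unshelve. all: by end_near. Qed.

Lemma is_derive_translate (V W : normedModType R) (f : V -> W) z a v :
  derivable f (z + a) v -> is_derive z v (fun w => f (w + a)) ('D_v f (z + a)).
Proof.
move=> df.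
have E : (fun h : R => h^-1 *: (((fun w => f (w + a)) \o shift z) (h *: v)
            - f (z + a))) =
  (fun h => h^-1 *: ((f \o shift (z + a)) (h *: v) - f (z + a))).
  by apply/funext => h /=; rewrite addrA.
by apply: DeriveDef; rewrite /derivable /derive /= E.
Qed.

(** The mean value theorem is applied to [f (z + t *: y) - f z] along [x], and the first-order
    expansion of ['D_x f] at [u] to the result. The error is enlarged to a bound symmetric in [x]
    and [y], so that it serves again with their roles exchanged. *)
Lemma second_difference (V : normedModType R) (f : V -> R) u x y eps :
  (\near u, differentiable f u) -> differentiable ('D_x f) u -> 0 < eps ->
  \forall t \near 0^'+,
    `|f (u + t *: x + t *: y) - f (u + t *: x) - f (u + t *: y) + f u
       - t ^+ 2 * 'D_y ('D_x f) u| <= eps * (2 * `|x| + 2 * `|y|) * t ^+ 2.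
Proof.
move=> df dA e0; pose A := 'D_x f.
have : \forall h \near (0 : V), differentiable f (u + h) /\
    `|A (u + h) - A u - 'd A u h| <= eps * `|h|.
  have H1 : \forall h \near (0 : V), differentiable f (u + h).
    exact: ((nbhs0P (fun w => differentiable f w) u).1 df).
  have /diff_locallyP [_ /eqaddoP /(_ eps e0)] := dA.
  apply: filterS2 (H1) => h /= dfh. rewrite !fctE /= => H; split=> //.
  by rewrite [u + h]addrC -addrA -opprD.
case/nbhs_ballP => d /= d0 Hd.
(* The summand 1 keeps [C] positive when [x] and [y] vanish; [t * C < d] keeps the parallelogram
   inside the ball where the expansion is valid. *)
pose C := `|x| + `|y| + 1.
have C0 : 0 < C by rewrite /C ltr_wpDl// addr_ge0.
near=> t.
have t0 : 0 < t by near: t; exact: nbhs_right_gt.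
have tC : t * C < d.
  by rewrite -ltr_pdivlMr //; near: t; apply: nbhs_right_lt; rewrite divr_gt0.
have inb (s r : R) : 0 <= s <= 1 -> 0 <= r <= 1 ->
    `|(s * t) *: x + (r * t) *: y| <= t * (s * `|x| + r * `|y|).
  move=> /andP[s0 _] /andP[r0 _]; apply: le_trans (ler_normD _ _) _.
  rewrite !normrZ !ger0_norm ?(ltW t0)//.
  by rewrite mulrDr !mulrA ![_ * t]mulrC.
have inb' (s r : R) : 0 <= s <= 1 -> 0 <= r <= 1 ->
    ball 0 d ((s * t) *: x + (r * t) *: y).
  move=> s01 r01; rewrite -ball_normE /= sub0r normrN.
  apply: le_lt_trans (inb s r s01 r01) _; apply: le_lt_trans tC.
  rewrite ler_pM2l// /C.
  case/andP: s01 => s0 s1; case/andP: r01 => r0 r1.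
  have := ler_piMl (normr_ge0 x) s1; have := ler_piMl (normr_ge0 y) r1; lra.
have dgs s : 0 <= s <= 1 ->
   is_derive (u + (s * t) *: x) x (fun z => f (z + t *: y) - f z)
      (A (u + (s * t) *: x + t *: y) - A (u + (s * t) *: x)).
  move=> s01; apply: is_deriveB; last first.
    have [|dfz _] := Hd ((s * t) *: x).
      have := inb' s 0 s01; rewrite mul0r scale0r addr0; apply.
      by rewrite lexx ler01.
    by split => //; exact: diff_derivable.
  apply: is_derive_translate; apply: diff_derivable; rewrite -addrA.
  have := inb' s 1 s01; rewrite mul1r => H; apply: (Hd _ (H _)).1.
  by rewrite lexx ler01.
have [s s01 E] := @MVT_line _ (fun z => f (z + t *: y) - f z) u x t
  (fun s s01 => @ex_derive _ _ _ _ _ _ _ (dgs s s01)).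
have Dg := @derive_val _ _ _ _ _ _ _ (dgs s s01).
rewrite Dg in E.
have i1 : 0 <= (1 : R) <= 1 by rewrite lexx ler01.
have i0 : 0 <= (0 : R) <= 1 by rewrite lexx ler01.
have [_ B1] := Hd _ (inb' s 1 s01 i1).
have [_ B2] := Hd _ (inb' s 0 s01 i0).
have N1 := inb s 1 s01 i1.
have N2 := inb s 0 s01 i0.
move: B1 B2 N1 N2; rewrite mul1r mul0r scale0r addr0 => B1 B2 N1 N2.
have -> : f (u + t *: x + t *: y) - f (u + t *: x) - f (u + t *: y) + f u =
   t * (A (u + (s * t) *: x + t *: y) - A (u + (s * t) *: x)).
  by rewrite -E; ring.
rewrite -/A.
have dAt : 'd A u (t *: y) = t * 'D_y A u by rewrite linearZ deriveE.
rewrite [u + (_ + _)]addrA in B1.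
set a1 := A (u + _ + _) in B1 *; set a2 := A (u + _) in B2 *.
rewrite linearD dAt in B1.
set dx := 'd A u ((s * t) *: x) in B1 B2.
set D := 'D_y A u in B1 *.
have -> : t * (a1 - a2) - t ^+ 2 * D =
   t * ((a1 - A u - (dx + t * D)) - (a2 - A u - dx)) by ring.
rewrite normrM gtr0_norm// expr2 mulrA [leRHS]mulrC ler_pM2l//.
apply: le_trans (ler_normB _ _) _; apply: le_trans (lerD B1 B2) _.
rewrite -mulrDr -mulrA ler_pM2l//; apply: le_trans (lerD N1 N2) _.
rewrite -mulrDr mulrC ler_pM2r//.
case/andP: s01 => s0 s1.
have := ler_piMl (normr_ge0 x) s1; have := normr_ge0 y; lra.
Unshelve. all: by end_near. Qed.

(** The second difference is symmetric in [x] and [y], so both mixed derivatives are its limit after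
    division by [t ^+ 2]. *)
Lemma derive_comm_real (V : normedModType R) (f : V -> R) u x y :
  (\near u, differentiable f u) ->
  differentiable ('D_x f) u -> differentiable ('D_y f) u ->
  'D_x ('D_y f) u = 'D_y ('D_x f) u.
Proof.
move=> df dx dy.
set D1 := 'D_x _ u; set D2 := 'D_y _ u.
pose C := 2 * `|x| + 2 * `|y|.
have C0 : 0 <= C by rewrite addr_ge0// mulr_ge0.
apply/eqP; rewrite -subr_eq0 -normr_le0 leNgt; apply/negP => D0.
(* With this choice [2 * eps * C] is at most half the distance from [D1] to [D2], a contradiction
   with [D0]; since [C] may be 0, the divisor uses [C + 1]. *)
pose eps := `|D1 - D2| / (4 * (C + 1)).
have C1 : 0 < C + 1 by rewrite ltr_wpDl.
have e0 : 0 < eps by rewrite divr_gt0// mulr_gt0.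
suff : `|D1 - D2| <= 2 * eps * C.
  rewrite /eps => H.
  have := divfK (lt0r_neq0 (mulr_gt0 (ltr0n R 4) C1)) `|D1 - D2|.
  by rewrite -/eps in H *; nra.
near (0 : R)^'+ => t.
have t0 : 0 < t by near: t; exact: nbhs_right_gt.
have H1 : `|f (u + t *: x + t *: y) - f (u + t *: x) - f (u + t *: y) + f u
       - t ^+ 2 * D2| <= eps * C * t ^+ 2.
  by near: t; exact: second_difference.
have H2 : `|f (u + t *: y + t *: x) - f (u + t *: y) - f (u + t *: x) + f u
       - t ^+ 2 * D1| <= eps * (2 * `|y| + 2 * `|x|) * t ^+ 2.
  by near: t; exact: second_difference.
rewrite [2 * `|y| + _]addrC -/C [u + t *: y + _]addrAC in H2.
have t2 : 0 < t ^+ 2 by rewrite exprn_gt0.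
rewrite -(ler_pM2r t2) -[X in _ * X <= _](gtr0_norm t2) -normrM.
have -> : (D1 - D2) * t ^+ 2 =
   (f (u + t *: x + t *: y) - f (u + t *: x) - f (u + t *: y) + f u
       - t ^+ 2 * D2) - (f (u + t *: x + t *: y) - f (u + t *: y) - f (u + t *: x) + f u
       - t ^+ 2 * D1) by ring.
apply: le_trans (ler_normB _ _) _; apply: le_trans (lerD H1 H2) _.
by rewrite le_eqVlt; apply/orP; left; apply/eqP; ring.
Unshelve. all: by end_near. Qed.

End MeanValue.

(** * From partial derivatives to Fréchet differentiability and commuting derivatives *)

Section Smoothness.
Context {R : realType}.

Lemma open_near (T : topologicalType) (O : set T) x :
  open O -> O x -> \forall y \near x, O y.
Proof. by move=> oO Ox; apply: open_nbhs_nbhs. Qed.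

(** At every order [Ck_on] includes continuity, so one order more makes the partial derivatives
    continuous, and [differentiable_partials] applies to each entry. *)
Lemma Ck_on_differentiable m p q k (O : set 'rV[R]_m) (F : 'rV[R]_m -> 'M[R]_(p, q)) x :
  open O -> Ck_on k.+1 O F -> O x -> differentiable F x.
Proof.
move=> oO [_ CF] Ox; apply: differentiable_mx => i j.
have dF y l : O y -> derivable F y (bvec R l) by apply: (CF l).1.
have De y l : O y -> ('D_(bvec R l) F y) i j = 'D_(bvec R l) (fun z => F z i j) y.
  by move=> Oy; apply: derive_entry; exact: dF.
apply: differentiable_partials.
  apply: filterS (open_near oO Ox) => y Oy l.
  exact: ((derivable_mxP F y (bvec R l)).1 (dF y l Oy)).
move=> l.
have cD : {for x, continuous ('D_(bvec R l) F)}.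
  by have [_] := CF l; case: (k) => [|k'] [+ _]; apply.
have : {for x, continuous (fun y => ('D_(bvec R l) F y) i j)}.
  apply: (@continuous_comp _ _ _ ('D_(bvec R l) F) (fun N => N i j) x) => //.
  exact: coord_continuous.
rewrite /prop_for /continuous_at De// => H.
have E : \forall y \near x, ('D_(bvec R l) F y) i j = 'D_(bvec R l) (fun z => F z i j) y.
  by apply: filterS (open_near oO Ox) => y Oy; rewrite De.
exact: cvg_trans (near_eq_cvg E) H.
Qed.

Lemma derive_comm (V : normedModType R) p q (F : V -> 'M[R]_(p, q)) u x y :
  (\near u, differentiable F u) ->
  differentiable ('D_x F) u -> differentiable ('D_y F) u ->
  'D_x ('D_y F) u = 'D_y ('D_x F) u.
Proof.
move=> dF dx dy; apply/matrixP => i j.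
have dyx : derivable ('D_y F) u x by exact: diff_derivable.
have dxy : derivable ('D_x F) u y by exact: diff_derivable.
apply: etrans (derive_entry i j dyx) _.
apply: etrans _ (esym (derive_entry i j dxy)).
have E v : \forall w \near u, ('D_v F w) i j = 'D_v (fun y => F y i j) w.
  by apply: filterS dF => w dw; apply: derive_entry; exact: diff_derivable.
rewrite (near_eq_derive _ (E x)) (near_eq_derive _ (E y)).
apply: derive_comm_real.
- by apply: filterS dF => w dw; exact: differentiable_entry.
- exact: (differentiable_near_eq (E x) (differentiable_entry _ _ dx)).
- exact: (differentiable_near_eq (E y) (differentiable_entry _ _ dy)).
Qed.

Lemma derive_dirE (V : normedModType R) m (F : 'rV[R]_m -> V) x v :
  differentiable F x ->
  'D_v F x = \sum_i v 0 i *: 'D_(bvec R i) F x.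
Proof. by move=> dF; rewrite {1}(row_sum_bvec v) derive_sum_dir. Qed.

Section C2.
Variables (m p q : nat) (O : set 'rV[R]_m) (F : 'rV[R]_m -> 'M[R]_(p, q)).
Hypotheses (oO : open O) (sF : smooth_on O F).

Lemma smooth_differentiable x : O x -> differentiable F x.
Proof. by apply: Ck_on_differentiable oO (sF 1%N). Qed.

Lemma smooth_near_differentiable x : O x -> \forall y \near x, differentiable F y.
Proof.
by move=> Ox; apply: filterS (open_near oO Ox) => y; exact: smooth_differentiable.
Qed.

Lemma smooth_partial i : smooth_on O ('D_(bvec R i) F).
Proof. by move=> k; have [_ /(_ i) []] := sF k.+1. Qed.

Lemma smooth_near_dirE x (v : 'rV[R]_m) : O x ->
  \forall y \near x, \sum_i v 0 i *: 'D_(bvec R i) F y = 'D_v F y.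
Proof.
move=> Ox; apply: filterS (open_near oO Ox) => y Oy.
by rewrite derive_dirE//; exact: smooth_differentiable.
Qed.

Lemma differentiable_partial x i : O x -> differentiable ('D_(bvec R i) F) x.
Proof. by apply: Ck_on_differentiable oO (smooth_partial i 1%N). Qed.

Lemma smooth_derive_differentiable x v : O x -> differentiable ('D_v F) x.
Proof.
move=> Ox; apply: differentiable_near_eq (smooth_near_dirE v Ox) _.
rewrite (_ : (fun _ => _) = \sum_i (v 0 i *: 'D_(bvec R i) F)).
  apply: differentiable_sum => i; apply: differentiableZ.
  exact: differentiable_partial.
by apply/funext => y; rewrite fct_sumE.
Qed.

Lemma smooth_derive_comm u x y : O u -> 'D_x ('D_y F) u = 'D_y ('D_x F) u.
Proof.
move=> Ou; apply: derive_comm; first exact: smooth_near_differentiable.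
- exact: smooth_derive_differentiable.
- exact: smooth_derive_differentiable.
Qed.

End C2.

End Smoothness.

(** * Bilinear forms *)

Section InnerProduct.
Context {R : realType} {m : nat}.
Implicit Types (A B : 'M[R]_m) (X Y Z : 'rV[R]_m).

Lemma inprodDl A X Y Z : inprod A (X + Y) Z = inprod A X Z + inprod A Y Z.
Proof. by rewrite /inprod !mulmxDl mxE. Qed.

Lemma inprodDr A X Y Z : inprod A X (Y + Z) = inprod A X Y + inprod A X Z.
Proof. by rewrite /inprod linearD mulmxDr mxE. Qed.

Lemma inprodZl A a X Y : inprod A (a *: X) Y = a * inprod A X Y.
Proof. by rewrite /inprod -!scalemxAl mxE. Qed.

Lemma inprodZr A a X Y : inprod A X (a *: Y) = a * inprod A X Y.
Proof. by rewrite /inprod linearZ -scalemxAr mxE. Qed.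

Lemma inprodNl A X Y : inprod A (- X) Y = - inprod A X Y.
Proof. by rewrite -scaleN1r inprodZl mulN1r. Qed.

Lemma inprodNr A X Y : inprod A X (- Y) = - inprod A X Y.
Proof. by rewrite -scaleN1r inprodZr mulN1r. Qed.

Lemma inprod0l A Y : inprod A 0 Y = 0.
Proof. by rewrite -(scale0r 0) inprodZl mul0r. Qed.

Lemma inprod0r A Y : inprod A Y 0 = 0.
Proof. by rewrite -(scale0r 0) inprodZr mul0r. Qed.

Lemma inprod_suml A (I : finType) (F : I -> 'rV[R]_m) Y :
  inprod A (\sum_i F i) Y = \sum_i inprod A (F i) Y.
Proof. by rewrite /inprod !mulmx_suml summxE. Qed.

Lemma inprod_sumr A (I : finType) (F : I -> 'rV[R]_m) Y :
  inprod A Y (\sum_i F i) = \sum_i inprod A Y (F i).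
Proof. by rewrite /inprod linear_sum mulmx_sumr summxE. Qed.

Lemma inprodZm a A X Y : inprod (a *: A) X Y = a * inprod A X Y.
Proof. by rewrite /inprod -scalemxAr -scalemxAl mxE. Qed.

Lemma inprod_summ (I : finType) (F : I -> 'M[R]_m) X Y :
  inprod (\sum_i F i) X Y = \sum_i inprod (F i) X Y.
Proof. by rewrite /inprod mulmx_sumr mulmx_suml summxE. Qed.

Lemma inprod_tr A X Y : inprod A^T X Y = inprod A Y X.
Proof.
rewrite /inprod; have -> : X *m A^T *m Y^T = (Y *m A *m X^T)^T.
  by rewrite !trmx_mul trmxK mulmxA.
by rewrite mxE.
Qed.

Lemma inprod_sym A X Y : A^T = A -> inprod A X Y = inprod A Y X.
Proof. by move=> sA; rewrite -{1}sA inprod_tr. Qed.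

Lemma derive_inprod_cst (V : normedModType R) (A : V -> 'M[R]_m) X Y x v :
  differentiable A x ->
  'D_v (fun y => inprod (A y) X Y) x = inprod ('D_v A x) X Y.
Proof.
move=> dA; have dX : differentiable (cst X : V -> _) x by [].
have dY : differentiable (cst Y : V -> _) x by [].
apply: etrans (derive_inprod v dA dX dY) _.
by rewrite (derive_cst X) (derive_cst Y) inprod0l inprod0r !addr0.
Qed.

Lemma inprod_bvec A i j : inprod A (bvec R i) (bvec R j) = A i j.
Proof. by rewrite /inprod /bvec -rowE trmx_delta -colE !mxE. Qed.

Lemma inprod_bvecl A X i : inprod A (bvec R i) X = \sum_j A i j * X 0 j.
Proof. by rewrite /inprod /bvec -rowE mxE; apply: eq_bigr => j _; rewrite !mxE. Qed.

Lemma inprodE A X Y : inprod A X Y = \sum_i \sum_j X 0 i * (Y 0 j * A i j).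
Proof.
rewrite {1}(row_sum_bvec X) inprod_suml; apply: eq_bigr => i _.
rewrite {1}(row_sum_bvec Y) inprod_sumr; apply: eq_bigr => j _.
by rewrite inprodZl inprodZr inprod_bvec.
Qed.

(* [D X] plays the role of the derivative of the metric [A] in the direction [X]. *)
Section Koszul.
Variables (A : 'M[R]_m) (D : 'rV[R]_m -> 'M[R]_m).
Hypotheses (sA : A^T = A) (sD : forall X, (D X)^T = D X).

(** The row lists the Koszul expression on basis vectors and the inverse of [A] raises its index;
    pairing with [Z] through [A] undoes this, and linearity of [D] in its direction replaces the
    basis by [Z]. *)
Lemma koszul_solve X Y Z : A \in unitmx ->
  D Z = \sum_i Z 0 i *: D (bvec R i) ->
  2 * inprod A (2^-1 *: ((\row_l (inprod (D X) (bvec R l) Y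
    + inprod (D Y) (bvec R l) X - inprod (D (bvec R l)) X Y)) *m (invmx A)^T)) Z
  = inprod (D X) Y Z + inprod (D Y) X Z - inprod (D Z) X Y.
Proof.
move=> uA dZ; rewrite inprodZl mulrA mulfV ?pnatr_eq0// mul1r.
rewrite {1}/inprod trmx_inv sA mulmxKV// mxE.
under eq_bigr => l _ do rewrite !mxE mulrC mulrBr mulrDr -!inprodZl.
rewrite sumrB big_split /= -!inprod_suml -!row_sum_bvec.
rewrite (inprod_sym Z Y (sD X)) (inprod_sym Z X (sD Y)).
congr (_ + _ - _); rewrite dZ inprod_summ.
by apply: eq_bigr => l _; rewrite inprodZm inprodZl.
Qed.

(** Adding the Koszul identities for [(c, X, Y)] and [(c, Y, X)] cancels the terms differentiated
    along [X] and [Y]. *)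
Lemma koszul_compat (C : 'rV[R]_m -> 'rV[R]_m -> 'rV[R]_m) c X Y :
  (forall X Y Z, 2 * inprod A (C X Y) Z =
    inprod (D X) Y Z + inprod (D Y) X Z - inprod (D Z) X Y) ->
  inprod (D c) X Y = inprod A (C c X) Y + inprod A X (C c Y).
Proof.
move=> K; have k1 := K c X Y; have k2 := K c Y X.
rewrite (inprod_sym X (C _ _) sA); rewrite (inprod_sym Y X (sD c)) in k2.
by lra.
Qed.

End Koszul.

Lemma inprod_pos_unit A : (forall X, X != 0 -> 0 < inprod A X X) -> A \in unitmx.
Proof.
move=> pA; rewrite -row_free_unit -kermx_eq0; apply/rowV0P => v.
move=> /sub_kermxP vA; apply/eqP/negPn/negP => /pA.
by rewrite /inprod vA mul0mx mxE ltxx.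
Qed.

(** With the vectors [e i] as rows of [E], the product [E *m A *m E^T] is diagonal, which expresses
    the inverse of [A] through [E]; cyclicity of the trace then brings out the values of [B] on the
    frame. *)
Lemma trace_frame A B (e : 'I_m -> 'rV[R]_m) (d : 'I_m -> R) :
  (forall i j, inprod A (e i) (e j) = d i * (i == j)%:R) ->
  (forall i, d i != 0) ->
  \tr (invmx A *m B) = \sum_i inprod B (e i) (e i) / d i.
Proof.
move=> Ae d0.
pose E : 'M[R]_m := \matrix_(i, j) e i 0 j.
have EME C i j : (E *m C *m E^T) i j = inprod C (e i) (e j).
  have r k : row k E = e k by apply/rowP => l; rewrite !mxE.
  rewrite /inprod -!r -row_mul tr_row !mxE.
  by apply: eq_bigr => k _; rewrite !mxE.
have EAE : E *m A *m E^T = diag_mx (\row_i d i).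
  by apply/matrixP => i j; rewrite EME Ae !mxE mulr_natr.
have Du : diag_mx (\row_i d i) \in unitmx.
  by rewrite unitmxE det_diag unitfE; apply/prodf_neq0 => i _; rewrite mxE.
(* Invertibility of both [E] and [A] is read off this product. *)
have : E *m A *m E^T \in unitmx by rewrite EAE.
rewrite !unitmx_mul unitmx_tr andbAC andbb => /andP[uE uA].
have uT : E^T \in unitmx by rewrite unitmx_tr.
pose D' : 'M[R]_m := diag_mx (\row_i (d i)^-1).
have DD : D' *m diag_mx (\row_i d i) = 1%:M.
  apply/matrixP => i j; rewrite mul_diag_mx !mxE.
  by case: eqVneq => [->|_]; rewrite ?mulr1n ?mulr0n ?mulr0 // mulVf.
have -> : invmx A = E^T *m D' *m E.
  apply: (can_inj (mulKmx uA)); rewrite mulmxV//; apply/esym.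
  apply: (can_inj (mulKmx uE)); rewrite mulmx1 !mulmxA EAE.
  apply: (can_inj (mulmxK uT)).
  have /mulmx1C -> : D' *m diag_mx (\row_i d i) = 1%:M := DD.
  by rewrite mul1mx.
rewrite -!mulmxA mxtrace_mulC -!mulmxA.
apply: eq_bigr => i _.
by rewrite mul_diag_mx mxE mulmxA EME !mxE mulrC.
Qed.

End InnerProduct.

(** * Christoffel symbols *)

Section Invmx.
Context {R : realType} {V : normedModType R}.

Lemma differentiable_bigprod (I : Type) (s : seq I) (F : I -> V -> R) x :
  (forall i, differentiable (F i) x) ->
  differentiable (fun y => \prod_(i <- s) F i y) x.
Proof.
move=> dF; elim: s => [|i s IH].
  by rewrite (_ : (fun _ => _) = cst 1)//; apply/funext => y; rewrite big_nil.
rewrite (_ : (fun _ => _) = F i * (fun y => \prod_(i <- s) F i y)).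
  exact: differentiableM.
by apply/funext => y; rewrite big_cons.
Qed.

Lemma differentiable_bigsum (I : Type) (s : seq I) (F : I -> V -> R) x :
  (forall i, differentiable (F i) x) ->
  differentiable (fun y => \sum_(i <- s) F i y) x.
Proof.
move=> dF; elim: s => [|i s IH].
  by rewrite (_ : (fun _ => _) = cst 0)//; apply/funext => y; rewrite big_nil.
rewrite (_ : (fun _ => _) = F i + (fun y => \sum_(i <- s) F i y)).
  exact: differentiableD.
by apply/funext => y; rewrite big_cons.
Qed.

Lemma differentiable_det m (A : V -> 'M[R]_m) x :
  differentiable A x -> differentiable (fun y => \det (A y)) x.
Proof.
move=> dA; apply: differentiable_bigsum => s.
apply: (@differentiableM _ _ (cst _) (fun y => \prod_i A y i (fun_of_perm s i))) => //.
by apply: differentiable_bigprod => j; exact: differentiable_entry.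
Qed.

Lemma differentiable_invmx m (A : V -> 'M[R]_m) x :
  differentiable A x -> (\forall y \near x, A y \in unitmx) ->
  differentiable (fun y => invmx (A y)) x.
Proof.
move=> dA uA.
(* The adjugate formula describes [invmx] on invertible matrices only; elsewhere [invmx] returns its
   argument. *)
have E : \forall y \near x, (\det (A y))^-1 *: \adj (A y) = invmx (A y).
  by apply: filterS uA => y uy; rewrite /invmx uy.
apply: differentiable_near_eq E _; apply: differentiable_mx => i j.
rewrite (_ : (fun _ => _) = (fun y => (\det (A y))^-1) *
    ((-1) ^+ (j + i) *: (fun y => \det (row' j (col' i (A y)))))); last first.
  by apply/funext => y; rewrite !mxE.
apply: differentiableM.
  apply: differentiableV; first exact: differentiable_det.
  by have := nbhs_singleton uA; rewrite unitmxE unitfE.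
apply: differentiableZ; apply: differentiable_det; apply: differentiable_mx => k l.
rewrite (_ : (fun _ => _) = (fun y => A y (lift j k) (lift i l))).
  exact: differentiable_entry.
by apply/funext => y; rewrite !mxE.
Qed.

End Invmx.

Section Connection.
Context {R : realType} {m : nat}.
Variable G : 'rV[R]_m -> 'M[R]_m.
Implicit Types X Y Z c : 'rV[R]_m.

(** Collecting the symbols with upper index [i] in a matrix makes each component of [Gamma] an
    [inprod], so bilinearity and the product rule carry over. *)
Definition chr_mx (i : 'I_m) (u : 'rV[R]_m) : 'M[R]_m :=
  \matrix_(j, k) christoffel G u i j k.

Definition dGamma (u c X Y : 'rV[R]_m) : 'rV[R]_m :=
  \row_i inprod ('D_c (chr_mx i) u) X Y.

Lemma Gamma_chr u X Y : Gamma G u X Y = \row_i inprod (chr_mx i u) X Y.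
Proof.
apply/rowP => i; rewrite !mxE inprodE; apply: eq_bigr => j _.
by apply: eq_bigr => k _; rewrite mxE; ring.
Qed.

Lemma GammaDl u X Y Z : Gamma G u (X + Y) Z = Gamma G u X Z + Gamma G u Y Z.
Proof. by rewrite !Gamma_chr; apply/rowP => i; rewrite !mxE inprodDl. Qed.

Lemma GammaDr u X Y Z : Gamma G u X (Y + Z) = Gamma G u X Y + Gamma G u X Z.
Proof. by rewrite !Gamma_chr; apply/rowP => i; rewrite !mxE inprodDr. Qed.

Lemma GammaZl u a X Y : Gamma G u (a *: X) Y = a *: Gamma G u X Y.
Proof. by rewrite !Gamma_chr; apply/rowP => i; rewrite !mxE inprodZl. Qed.

Lemma GammaZr u a X Y : Gamma G u X (a *: Y) = a *: Gamma G u X Y.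
Proof. by rewrite !Gamma_chr; apply/rowP => i; rewrite !mxE inprodZr. Qed.

Lemma Gamma0l u X : Gamma G u 0 X = 0.
Proof. by rewrite -(scale0r 0) GammaZl !scale0r. Qed.

Lemma Gamma0r u X : Gamma G u X 0 = 0.
Proof. by rewrite -(scale0r 0) GammaZr !scale0r. Qed.

Lemma derive_sym u X : differentiable G u -> (\forall v \near u, (G v)^T = G v) ->
  ('D_X G u)^T = 'D_X G u.
Proof.
move=> dG sG; rewrite -derive_trmx//; exact: near_eq_derive.
Qed.

Section AtPoint.
Variable u : 'rV[R]_m.
Hypotheses (dG : differentiable G u) (sG : \forall v \near u, (G v)^T = G v).

Lemma dgramE j l k : dgram G j l k u = ('D_(bvec R j) G u) l k.
Proof. by rewrite (derive_entry l k (diff_derivable dG)). Qed.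

Lemma christoffel_sym i j k : christoffel G u i j k = christoffel G u i k j.
Proof.
congr (_ * _); apply: eq_bigr => l _; congr (_ * _).
rewrite [X in X - _]addrC; congr (_ - _).
rewrite !dgramE; have /matrixP/(_ k j) := derive_sym (bvec R l) dG sG.
by rewrite mxE.
Qed.

Lemma chr_mx_sym i : (chr_mx i u)^T = chr_mx i u.
Proof. by apply/matrixP => j k; rewrite !mxE christoffel_sym. Qed.

Lemma Gamma_sym X Y : Gamma G u X Y = Gamma G u Y X.
Proof.
by rewrite !Gamma_chr; apply/rowP => i; rewrite !mxE inprod_sym// chr_mx_sym.
Qed.

(** This is the vector that [koszul_solve] pairs with [Z]: after it the Koszul formula needs no
    further work with indices. *)
Lemma GammaE X Y : Gamma G u X Y = 2^-1 *: ((\row_l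
  (inprod ('D_X G u) (bvec R l) Y + inprod ('D_Y G u) (bvec R l) X
   - inprod ('D_(bvec R l) G u) X Y)) *m (invmx (G u))^T).
Proof.
apply/rowP => i; rewrite !mxE.
have -> : \sum_j \sum_k christoffel G u i j k * X 0 j * Y 0 k =
  2^-1 * \sum_l invmx (G u) i l * (\sum_j \sum_k
    (dgram G j l k u + dgram G k l j u - dgram G l j k u) * X 0 j * Y 0 k).
  under eq_bigr => j _ do under eq_bigr => k _ do
    rewrite /christoffel -mulrA -mulrA mulr_suml.
  under eq_bigr => j _ do rewrite -mulr_sumr.
  rewrite -mulr_sumr; congr (_ * _).
  under eq_bigr => j _ do rewrite exchange_big /=.
  rewrite exchange_big /=; apply: eq_bigr => l _.
  rewrite mulr_sumr; apply: eq_bigr => j _.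
  by rewrite mulr_sumr; apply: eq_bigr => k _; rewrite -!mulrA.
congr (_ * _); apply: eq_bigr => l _; rewrite !mxE mulrC; congr (_ * _).
have hD Z W : inprod ('D_Z G u) (bvec R l) W =
    \sum_j \sum_k Z 0 j * (W 0 k * dgram G j l k u).
  rewrite (derive_dirE Z dG) inprod_summ; apply: eq_bigr => j _.
  rewrite inprodZm inprod_bvecl mulr_sumr; apply: eq_bigr => k _.
  by rewrite dgramE [W 0 k * _]mulrC.
rewrite (hD X Y) (hD Y X) [X in _ + X - _]exchange_big /= inprodE.
rewrite -big_split -sumrB /=.
apply: eq_bigr => j _; rewrite -big_split -sumrB /=; apply: eq_bigr => k _.
by rewrite !dgramE; ring.
Qed.

Hypothesis uG : G u \in unitmx.

Lemma koszul X Y Z : 2 * inprod (G u) (Gamma G u X Y) Z =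
  inprod ('D_X G u) Y Z + inprod ('D_Y G u) X Z - inprod ('D_Z G u) X Y.
Proof.
rewrite GammaE; apply: (@koszul_solve _ _ _ (fun V => 'D_V G u)) => //.
- exact: nbhs_singleton sG.
- by move=> V; exact: derive_sym.
- exact: derive_dirE.
Qed.

Lemma metric_compat c X Y : inprod ('D_c G u) X Y =
  inprod (G u) (Gamma G u c X) Y + inprod (G u) X (Gamma G u c Y).
Proof.
apply: (@koszul_compat _ _ _ (fun V => 'D_V G u)); last exact: koszul.
- exact: nbhs_singleton sG.
- by move=> V; exact: derive_sym.
Qed.

End AtPoint.

Section OnOpen.
Variable O : set 'rV[R]_m.
Hypotheses (oO : open O) (smG : smooth_on O G)
  (symG : forall v, O v -> (G v)^T = G v) (uG : forall v, O v -> G v \in unitmx).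

Lemma differentiable_chr_mx i u : O u -> differentiable (chr_mx i) u.
Proof.
move=> Ou; apply: differentiable_mx => j k.
rewrite (_ : (fun _ => _) = 2^-1 *: \sum_l ((fun y => invmx (G y) i l) *
   (dgram G j l k + dgram G k l j - dgram G l j k))); last first.
  by apply/funext => y; rewrite mxE /christoffel fctE /= fct_sumE.
have dD a b d : differentiable (dgram G a b d) u.
  have E : \forall y \near u, ('D_(bvec R a) G y) b d = dgram G a b d y.
    apply: filterS (smooth_near_differentiable oO smG Ou) => y dy.
    by rewrite dgramE.
  apply: differentiable_near_eq E _; apply: differentiable_entry.
  exact: (differentiable_partial oO smG).
apply: differentiableZ; apply: differentiable_sum => l.
apply: differentiableM; last by apply: differentiableB => //; exact: differentiableD.
apply: differentiable_entry; apply: differentiable_invmx.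
  exact: (smooth_differentiable oO smG).
by apply: filterS (open_near oO Ou).
Qed.

Lemma dGamma_sym u c X Y : O u -> dGamma u c X Y = dGamma u c Y X.
Proof.
move=> Ou; apply/rowP => i; rewrite !mxE; apply: inprod_sym.
rewrite -derive_trmx; last exact: differentiable_chr_mx.
apply: near_eq_derive; apply: filterS (open_near oO Ou) => v Ov.
apply: chr_mx_sym; first exact: (smooth_differentiable oO smG).
by apply: filterS (open_near oO Ov).
Qed.

Lemma dGammaZl u a c X Y : O u -> dGamma u (a *: c) X Y = a *: dGamma u c X Y.
Proof.
move=> Ou; apply/rowP => i.
have E := derive_linear a c 0 (differentiable_chr_mx i Ou).
rewrite derive0 !addr0 in E; rewrite mxE [RHS]mxE [in RHS]mxE -inprodZm.
exact: (congr1 (fun A => inprod A X Y) E).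
Qed.

Lemma differentiable_Gamma (V : normedModType R) (p X Y : V -> 'rV[R]_m) x :
  O (p x) -> differentiable p x -> differentiable X x -> differentiable Y x ->
  differentiable (fun y => Gamma G (p y) (X y) (Y y)) x.
Proof.
move=> Op dp dX dY; apply: differentiable_mx => i j.
rewrite (_ : (fun _ => _) = fun y => inprod (chr_mx j (p y)) (X y) (Y y)).
  apply: differentiable_inprod => //.
  by apply: (differentiable_comp dp); exact: differentiable_chr_mx.
by apply/funext => y; rewrite Gamma_chr mxE.
Qed.

Lemma derive_Gamma (V : normedModType R) (p X Y : V -> 'rV[R]_m) x v :
  O (p x) -> differentiable p x -> differentiable X x -> differentiable Y x ->
  'D_v (fun y => Gamma G (p y) (X y) (Y y)) x =
  dGamma (p x) ('D_v p x) (X x) (Y x) + Gamma G (p x) ('D_v X x) (Y x)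
  + Gamma G (p x) (X x) ('D_v Y x).
Proof.
move=> Op dp dX dY; apply/rowP => j.
have dc := differentiable_chr_mx j Op.
rewrite derive_entry; last exact/diff_derivable/differentiable_Gamma.
rewrite (_ : (fun _ => _) = fun y => inprod (chr_mx j (p y)) (X y) (Y y)); last first.
  by apply/funext => y; rewrite Gamma_chr mxE.
rewrite derive_inprod//; last exact: (differentiable_comp dp).
by rewrite !Gamma_chr !mxE (derive_chain _ dp dc).
Qed.

End OnOpen.

End Connection.

(** * The Sasaki metric *)

Section LinearExpansion.
Context {R : realType} {m : nat}.

Lemma linear_rowE (W : lmodType R) (f : 'rV[R]_m -> W) v :
  linear f -> f v = \sum_i v 0 i *: f (bvec R i).
Proof.
move=> lf.
pose ff : {linear 'rV[R]_m -> W} := HB.pack f (GRing.isLinear.Build _ _ _ _ _ lf).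
rewrite -[f]/(ff : _ -> _) {1}(row_sum_bvec v) linear_sum.
by apply: eq_bigr => i _; rewrite linearZ.
Qed.

Lemma bilinear_inprodE (f : 'rV[R]_m -> 'rV[R]_m -> R) x y :
  (forall v, linear (f v : _ -> R^o)) -> (forall v, linear (f ^~ v : _ -> R^o)) ->
  f x y = inprod (\matrix_(i, j) f (bvec R i) (bvec R j)) x y.
Proof.
move=> lr ll; rewrite inprodE (linear_rowE x (ll y)); apply: eq_bigr => i _.
rewrite (linear_rowE y (lr _)) scaler_sumr; apply: eq_bigr => j _.
by rewrite mxE.
Qed.

Lemma derive_lsubmx p (z c : 'rV[R]_(m + p)) :
  'D_c (lsubmx : 'rV[R]_(m + p) -> 'rV[R]_m) z = lsubmx c.
Proof.
rewrite deriveE; last exact: differentiable_lsubmx.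
by rewrite diff_lin//; exact: continuous_lsubmx.
Qed.

Lemma derive_rsubmx p (z c : 'rV[R]_(m + p)) :
  'D_c (rsubmx : 'rV[R]_(m + p) -> 'rV[R]_p) z = rsubmx c.
Proof.
rewrite deriveE; last exact: differentiable_rsubmx.
by rewrite diff_lin//; exact: continuous_rsubmx.
Qed.

End LinearExpansion.

Section SasakiMetric.
Context {R : realType} {m : nat}.
Variable G : 'rV[R]_m -> 'M[R]_m.
Implicit Types z a b c : 'rV[R]_(m + m).

Lemma conn_map_linear z : linear (conn_map G z).
Proof.
move=> k a b; rewrite /conn_map !linearP /= GammaDr GammaZr scalerDr.
by rewrite addrACA.
Qed.

Lemma sasaki_linearr z a : linear (sasaki G z a : _ -> R^o).
Proof.
move=> k b c; rewrite /sasaki conn_map_linear !linearP /=.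
move: (conn_map G z a) (conn_map G z b) (conn_map G z c) => p q r.
rewrite !inprodDr !inprodZr.
by rewrite [_ *: _]mulrDr addrACA.
Qed.

Lemma sasaki_linearl z a : linear (sasaki G z ^~ a : _ -> R^o).
Proof.
move=> k b c; rewrite /sasaki conn_map_linear !linearP /=.
move: (conn_map G z a) (conn_map G z b) (conn_map G z c) => p q r.
rewrite !inprodDl !inprodZl.
by rewrite [_ *: _]mulrDr addrACA.
Qed.

(** As a matrix the metric can be differentiated with its two arguments held constant in the induced
    coordinates. *)
Definition sasaki_mx z : 'M[R]_(m + m) :=
  \matrix_(i, j) sasaki G z (bvec R i) (bvec R j).

Lemma sasakiE z a b : sasaki G z a b = inprod (sasaki_mx z) a b.
Proof.
by apply: bilinear_inprodE => v; [exact: sasaki_linearr|exact: sasaki_linearl].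
Qed.

Lemma sasaki_mx_sym z : (G (lsubmx z))^T = G (lsubmx z) ->
  (sasaki_mx z)^T = sasaki_mx z.
Proof.
move=> sG; apply/matrixP => i j; rewrite !mxE /sasaki.
by rewrite inprod_sym// [X in _ + X]inprod_sym.
Qed.

(** If the base component of [a] vanishes, [conn_map] returns its fibre component, so the two
    summands cannot vanish together. *)
Lemma sasaki_pos z a : (forall X, X != 0 -> 0 < inprod (G (lsubmx z)) X X) ->
  a != 0 -> 0 < sasaki G z a a.
Proof.
move=> pG a0.
have pG' X : 0 <= inprod (G (lsubmx z)) X X.
  by have [->|/pG/ltW//] := eqVneq X 0; rewrite inprod0l.
rewrite /sasaki; have [l0|l0] := eqVneq (lsubmx a) 0; last first.
  by rewrite ltr_pwDl ?pG.
have r0 : rsubmx a != 0.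
  by apply: contraNneq a0 => r0; rewrite -[a]hsubmxK l0 r0 row_mx0.
have Ka : conn_map G z a = rsubmx a.
  by rewrite /conn_map l0 Gamma0r addr0.
by rewrite Ka ltr_wpDl ?pG.
Qed.

(** The coordinate expression of R(x, y)v, for a vector [v] instead of a field: on TM the fibre
    coordinate is all there is. *)
Definition curv (u v x y : 'rV[R]_m) : 'rV[R]_m :=
  dGamma G u x v y - dGamma G u y v x + Gamma G u x (Gamma G u v y)
  - Gamma G u y (Gamma G u v x).

Section OnOpen.
Variable O : set 'rV[R]_m.
Hypotheses (oO : open O) (smG : smooth_on O G)
  (symG : forall v, O v -> (G v)^T = G v) (uG : forall v, O v -> G v \in unitmx).

Definition conn_map_deriv z c a : 'rV[R]_m :=
  dGamma G (lsubmx z) (lsubmx c) (rsubmx z) (lsubmx a)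
  + Gamma G (lsubmx z) (rsubmx c) (lsubmx a).

Lemma differentiable_conn_map z a : O (lsubmx z) ->
  differentiable (fun y => conn_map G y a) z.
Proof.
move=> Oz; apply: (@differentiableD _ _ _ (cst _)) => //.
apply: (differentiable_Gamma oO smG uG Oz) => //.
- exact: differentiable_lsubmx.
- exact: differentiable_rsubmx.
Qed.

Lemma derive_conn_map z c a : O (lsubmx z) ->
  'D_c (fun y => conn_map G y a) z = conn_map_deriv z c a.
Proof.
move=> Oz.
have dl : differentiable (lsubmx : 'rV[R]_(m + m) -> _) z by exact: differentiable_lsubmx.
have dr : differentiable (rsubmx : 'rV[R]_(m + m) -> _) z by exact: differentiable_rsubmx.
have dc : differentiable (cst (lsubmx a) : 'rV[R]_(m + m) -> 'rV[R]_m) z by [].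
have dK := differentiable_Gamma oO smG uG Oz dl dr dc.
rewrite /conn_map (@deriveD _ _ _ (cst _)); [|exact: derivable_cst|exact: diff_derivable].
rewrite derive_cst add0r (derive_Gamma oO smG uG c Oz dl dr dc).
rewrite derive_cst Gamma0r addr0.
by rewrite derive_lsubmx derive_rsubmx.
Qed.

Lemma differentiable_gram_base z : O (lsubmx z) ->
  differentiable (fun y : 'rV[R]_(m + m) => G (lsubmx y)) z.
Proof.
move=> Oz; apply: (@differentiable_comp _ _ _ _ lsubmx).
  exact: differentiable_lsubmx.
exact: (smooth_differentiable oO smG).
Qed.

Lemma differentiable_sasaki z a b : O (lsubmx z) ->
  differentiable (fun y => sasaki G y a b) z.
Proof.
move=> Oz; apply: differentiableD; apply: differentiable_inprod => //.
- exact: differentiable_gram_base.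
- exact: differentiable_gram_base.
- exact: differentiable_conn_map.
- exact: differentiable_conn_map.
Qed.

Lemma differentiable_sasaki_mx z : O (lsubmx z) -> differentiable sasaki_mx z.
Proof.
move=> Oz; apply: differentiable_mx => i j.
rewrite (_ : (fun _ => _) = fun y => sasaki G y (bvec R i) (bvec R j)).
  exact: differentiable_sasaki.
by apply/funext => y; rewrite mxE.
Qed.

Lemma derive_sasaki z c a b : O (lsubmx z) ->
  inprod ('D_c sasaki_mx z) a b =
  inprod ('D_(lsubmx c) G (lsubmx z)) (lsubmx a) (lsubmx b)
  + inprod ('D_(lsubmx c) G (lsubmx z)) (conn_map G z a) (conn_map G z b)
  + inprod (G (lsubmx z)) (conn_map_deriv z c a) (conn_map G z b)
  + inprod (G (lsubmx z)) (conn_map G z a) (conn_map_deriv z c b).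
Proof.
move=> Oz.
have dS := differentiable_sasaki_mx Oz.
rewrite -(derive_inprod_cst a b c dS).
rewrite (_ : (fun _ => _) = fun y => sasaki G y a b); last first.
  by apply/funext => y; rewrite sasakiE.
have dG := differentiable_gram_base Oz.
have dKa := differentiable_conn_map a Oz; have dKb := differentiable_conn_map b Oz.
rewrite /sasaki deriveD; [|exact/diff_derivable/differentiable_inprod..].
have E1 := derive_inprod_cst (lsubmx a) (lsubmx b) c dG.
have E2 := derive_inprod c dG dKa dKb.
rewrite (derive_conn_map c a Oz) (derive_conn_map c b Oz) in E2.
have dl : differentiable (lsubmx : 'rV[R]_(m + m) -> _) z by exact: differentiable_lsubmx.
have E3 := derive_chain c dl (smooth_differentiable oO smG Oz).
rewrite derive_lsubmx in E3; rewrite E3 in E1 E2.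
by apply: etrans (congr2 +%R E1 E2) _; rewrite !addrA.
Qed.

(** The Christoffel term makes the derivative covariant: [conn_map G z a] is differentiated as a
    tangent vector over the moving base point. *)
Definition conn_map_covd z c a : 'rV[R]_m :=
  Gamma G (lsubmx z) (lsubmx c) (conn_map G z a) + conn_map_deriv z c a.

(** Metric compatibility trades the derivative of [G] for Christoffel terms; those acting on values
    of [conn_map] are absorbed into [conn_map_covd]. *)
Lemma derive_sasaki_covd z c a b : O (lsubmx z) ->
  inprod ('D_c sasaki_mx z) a b =
  inprod (G (lsubmx z)) (Gamma G (lsubmx z) (lsubmx c) (lsubmx a)) (lsubmx b)
  + inprod (G (lsubmx z)) (lsubmx a) (Gamma G (lsubmx z) (lsubmx c) (lsubmx b))
  + inprod (G (lsubmx z)) (conn_map_covd z c a) (conn_map G z b)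
  + inprod (G (lsubmx z)) (conn_map G z a) (conn_map_covd z c b).
Proof.
move=> Oz; apply: etrans (derive_sasaki c a b Oz) _.
have sG : \forall v \near lsubmx z, (G v)^T = G v.
  by apply: filterS (open_near oO Oz).
have mc x y := metric_compat (smooth_differentiable oO smG Oz) sG (uG Oz) (lsubmx c) x y.
apply: (etrans (congr2 (fun X Y => X + Y + _ + _)
  (mc (lsubmx a) (lsubmx b)) (mc (conn_map G z a) (conn_map G z b)))).
rewrite /conn_map_covd.
move: (conn_map_deriv z c a) (conn_map_deriv z c b) => p q.
move: (conn_map G z a) (conn_map G z b) => k l.
by rewrite (inprodDl _ _ p) (inprodDr _ _ _ q); ring.
Qed.

(** The terms with the fibre components of [c] and [a] cancel by the symmetry of [Gamma].
    Invariantly, the curvature is the exterior covariant derivative of the connection map. *)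
Lemma conn_map_covd_curv z c a : O (lsubmx z) ->
  conn_map_covd z c a - conn_map_covd z a c =
  curv (lsubmx z) (rsubmx z) (lsubmx c) (lsubmx a).
Proof.
move=> Oz.
have sG : \forall v \near lsubmx z, (G v)^T = G v.
  by apply: filterS (open_near oO Oz).
have dG := smooth_differentiable oO smG Oz.
rewrite /curv /conn_map_covd /conn_map_deriv /conn_map !GammaDr.
rewrite (Gamma_sym dG sG (rsubmx a)) (Gamma_sym dG sG (rsubmx c)).
by apply/rowP => i; rewrite !mxE; ring.
Qed.

(** Half the derivative along [N] contributes [conn_map_covd z N a], whose difference from
    [conn_map_covd z a N] is curvature; the base terms with [Gamma] of [a] and [N] cancel. *)
Lemma sasaki_koszul z a N : O (lsubmx z) ->
  inprod ('D_a sasaki_mx z) a N - 2^-1 * inprod ('D_N sasaki_mx z) a a =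
  inprod (G (lsubmx z)) (Gamma G (lsubmx z) (lsubmx a) (lsubmx a)) (lsubmx N)
  + inprod (G (lsubmx z)) (conn_map_covd z a a) (conn_map G z N)
  + inprod (G (lsubmx z)) (conn_map G z a)
      (curv (lsubmx z) (rsubmx z) (lsubmx a) (lsubmx N)).
Proof.
move=> Oz; apply: (etrans (congr2 (fun X Y => X - 2^-1 * Y)
  (derive_sasaki_covd a a N Oz) (derive_sasaki_covd N a a Oz))).
have sG : \forall v \near lsubmx z, (G v)^T = G v.
  by apply: filterS (open_near oO Oz).
rewrite -(conn_map_covd_curv a N Oz).
rewrite (Gamma_sym (smooth_differentiable oO smG Oz) sG (lsubmx N)).
move: (conn_map_covd z a a) (conn_map_covd z a N) (conn_map_covd z N a) => A B C.
move: (conn_map G z a) (conn_map G z N) => k l.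
move: (Gamma _ _ (lsubmx a) (lsubmx a)) (Gamma _ _ (lsubmx a) (lsubmx N)) => p q.
have sGz := symG Oz.
rewrite (inprodDr _ k B) inprodNr.
rewrite (inprod_sym C k sGz) (inprod_sym q (lsubmx a) sGz).
by field.
Qed.

(** * Second covariant derivatives of a field and their curvature *)

Section SecondDerivatives.
Variables (xi : 'rV[R]_m -> 'rV[R]_m) (u : 'rV[R]_m).
Hypotheses (sxi : smooth_on O xi) (Ou : O u).

(** Constant extensions are not parallel: the covariant derivative of [cst y] along [x] is
    [Gamma G u x y], whence the last term. *)
Lemma rtenE x y : rten G xi u x y =
  'D_x ('D_y xi) u + dGamma G u x y (xi u) + Gamma G u y ('D_x xi u)
  + Gamma G u x ('D_y xi u) + Gamma G u x (Gamma G u y (xi u))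
  - nabla G xi u (Gamma G u x y).
Proof.
have dxi := smooth_differentiable oO sxi Ou.
have dDxi := smooth_derive_differentiable oO sxi y Ou.
have did : differentiable (id : 'rV[R]_m -> _) u by [].
have dc : differentiable (cst y : 'rV[R]_m -> 'rV[R]_m) u by [].
have dGa := differentiable_Gamma oO smG uG Ou did dc dxi.
rewrite /rten /second_covd /nabla /covd /=.
rewrite [X in X + _ - _]deriveD; [|exact: diff_derivable|exact: diff_derivable].
rewrite (derive_Gamma oO smG uG x Ou did dc dxi) derive_id !derive_cst add0r.
rewrite Gamma0l addr0 /= GammaDr.
by rewrite !addrA; congr (_ - _); rewrite [LHS]addrA.
Qed.

(** The second derivatives of [xi] commute and the terms with its first derivatives pair off by the
    symmetry of [Gamma], so only the value of [xi] at [u] survives. *)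
Lemma Riem_curv x y : Riem G xi u x y = curv u (xi u) x y.
Proof.
have sG : \forall v \near u, (G v)^T = G v by apply: filterS (open_near oO Ou).
have dG := smooth_differentiable oO smG Ou.
rewrite /Riem !rtenE /curv (Gamma_sym dG sG y x).
have E := smooth_derive_comm oO sxi x y Ou.
rewrite (dGamma_sym oO smG symG uG y x (xi u) Ou).
rewrite (dGamma_sym oO smG symG uG x y (xi u) Ou).
rewrite (Gamma_sym dG sG (xi u) y) (Gamma_sym dG sG (xi u) x).
move: E; move: ('D_x ('D_y xi) u) ('D_y ('D_x xi) u) => p q ->.
move: (nabla _ _ _ _) (dGamma G u x _ _) (dGamma G u y _ _) => a b d.
move: (Gamma _ _ y ('D_x xi u)) (Gamma _ _ x ('D_y xi u)) => r s.
move: (Gamma _ _ x _) (Gamma _ _ y _) => h k.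
by apply/rowP => i; rewrite !mxE; ring.
Qed.

Lemma RiemZr k x y : Riem G xi u x (k *: y) = k *: Riem G xi u x y.
Proof.
rewrite !Riem_curv /curv (dGammaZl oO smG uG k y (xi u) x Ou) !GammaZr GammaZl.
rewrite !scalerBr !scalerDr scalerN; congr (_ - _ + _ - _).
by apply/rowP => i; rewrite !mxE inprodZr.
Qed.

End SecondDerivatives.

End OnOpen.

End SasakiMetric.

(** * Second-order chain rule *)

Section SecondOrderChain.
Context {R : realType}.

Lemma differentiable_row_mx (V : normedModType R) p q
    (f : V -> 'rV[R]_p) (g : V -> 'rV[R]_q) x :
  differentiable f x -> differentiable g x ->
  differentiable (fun y => row_mx (f y) (g y)) x.
Proof.
move=> df dg; apply: differentiable_mx => i j; rewrite -(fintype.splitK j).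
case: (fintype.split j) => k.
  rewrite (_ : (fun _ => _) = fun y => f y i k); first exact: differentiable_entry.
  by apply/funext => y; rewrite row_mxEl.
rewrite (_ : (fun _ => _) = fun y => g y i k); first exact: differentiable_entry.
by apply/funext => y; rewrite row_mxEr.
Qed.

Lemma derive_row_mx (V : normedModType R) p q
    (f : V -> 'rV[R]_p) (g : V -> 'rV[R]_q) x v :
  differentiable f x -> differentiable g x ->
  'D_v (fun y => row_mx (f y) (g y)) x = row_mx ('D_v f x) ('D_v g x).
Proof.
move=> df dg; have dfg := differentiable_row_mx df dg.
have df' : derivable f x v by exact: diff_derivable.
have dg' : derivable g x v by exact: diff_derivable.
apply/rowP => j; apply: etrans (derive_entry 0 j (diff_derivable dfg)) _.
rewrite -(fintype.splitK j); case: (fintype.split j) => k.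
  rewrite row_mxEl; apply: etrans _ (esym (derive_entry 0 k df')).
  by congr ('D_v _ x); apply/funext => y; rewrite row_mxEl.
rewrite row_mxEr; apply: etrans _ (esym (derive_entry 0 k dg')).
by congr ('D_v _ x); apply/funext => y; rewrite row_mxEr.
Qed.

Section Jacobian.
Variables (m q : nat) (O : set 'rV[R]_m) (F : 'rV[R]_m -> 'rV[R]_q).
Hypotheses (oO : open O) (sF : smooth_on O F).

Lemma smooth_deriveEjacobian x v : O x -> 'D_v F x = v *m 'J F x.
Proof.
by move=> Ox; apply: deriveEjacobian; exact: (smooth_differentiable oO sF).
Qed.

Lemma differentiable_jacobian x : O x -> differentiable (jacobian F) x.
Proof.
move=> Ox; apply: differentiable_mx => i j.
have E : \forall y \near x, ('D_(bvec R i) F y) 0 j = 'J F y i j.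
  apply: filterS (open_near oO Ox) => y Oy.
  by rewrite (smooth_deriveEjacobian _ Oy) /bvec -rowE mxE.
apply: differentiable_near_eq E _; apply: differentiable_entry.
exact: (differentiable_partial oO sF).
Qed.

Lemma derive_jacobian x v w : O x -> w *m 'D_v (jacobian F) x = 'D_v ('D_w F) x.
Proof.
move=> Ox; have dJ := differentiable_jacobian Ox.
have dw : differentiable (cst w : 'rV[R]_m -> 'rV[R]_m) x by [].
have E : \forall y \near x, cst w y *m 'J F y = 'D_w F y.
  apply: filterS (open_near oO Ox) => y Oy.
  by rewrite (smooth_deriveEjacobian _ Oy).
apply: etrans _ (near_eq_derive v E); apply/esym.
by apply: etrans (derive_mulmx v dw dJ) _; rewrite derive_cst mul0mx add0r.
Qed.

Variables (V : normedModType R) (f : V -> 'rV[R]_m) (u : V).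
Hypotheses (ndf : \forall v \near u, differentiable f v) (Ofu : O (f u)).

Let Of_near : \forall v \near u, O (f v).
Proof.
have cf : {for u, continuous f}.
  exact/differentiable_continuous/(nbhs_singleton ndf).
exact: (cf _ (open_near oO Ofu)).
Qed.

(** In ['D_('D_x f v) F (f v)] both the direction and the base point vary with [v]; the Jacobian
    separates them into a product that can be differentiated again. *)
Lemma derive_comp_near x : \forall v \near u,
  'D_x f v *m 'J F (f v) = 'D_x (fun v => F (f v)) v.
Proof.
apply: filterS2 ndf Of_near => v dv Ov.
rewrite -(smooth_deriveEjacobian _ Ov); apply/esym; apply: derive_chain => //.
exact: (smooth_differentiable oO sF).
Qed.

Let dJf : differentiable (fun v => 'J F (f v)) u.
Proof.
apply: (@differentiable_comp _ _ _ _ f (jacobian F)); first exact: nbhs_singleton ndf.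
exact: differentiable_jacobian.
Qed.

Lemma differentiable_derive_comp x : differentiable ('D_x f) u ->
  differentiable ('D_x (fun v => F (f v))) u.
Proof.
move=> ddf; apply: differentiable_near_eq (derive_comp_near x) _.
exact: differentiable_mulmx.
Qed.

Lemma derive2_comp x : differentiable ('D_x f) u ->
  'D_x ('D_x (fun v => F (f v))) u =
  'D_('D_x ('D_x f) u) F (f u) + 'D_('D_x f u) ('D_('D_x f u) F) (f u).
Proof.
move=> ddf; apply: etrans (esym (near_eq_derive x (derive_comp_near x))) _.
apply: etrans (derive_mulmx x ddf dJf) _.
apply: congr2; first exact/esym/smooth_deriveEjacobian.
apply: etrans _ (derive_jacobian ('D_x f u) ('D_x f u) Ofu).
have dfu : differentiable f u by exact: nbhs_singleton ndf.
by rewrite (derive_chain x dfu (differentiable_jacobian Ofu)).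
Qed.

End Jacobian.

End SecondOrderChain.

(** * Charts of the unit tangent bundle *)

Section UnitTangentChart.
Context {R : realType} {n : nat} (M : riemannian R n.+1).
Variables (xi : unit_field M) (c : chart M) (t : unit_tangent_chart c).
Variable u : 'rV[R]_n.+1.
Hypotheses (Ou : img c u) (tu : utc_dom t (lift_pt xi c u)).

Local Notation g := (gram c).
Local Notation L := (lift_pt xi c).
Local Notation P := (utc_par t).
Local Notation F := (ut_map xi t).
Local Notation h := (ut_gram t).
Local Notation S := (sasaki_mx g).

Let oO : open (img c) := @img_open _ _ M c.
Let smG : smooth_on (img c) g := @gram_smooth _ _ M c.
Let symG : forall v, img c v -> (g v)^T = g v := @gram_sym _ _ M c.

Lemma gram_unit v : img c v -> g v \in unitmx.
Proof. by move=> Ov; apply: inprod_pos_unit => X; exact: gram_pos. Qed.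

Let uG := gram_unit.
Let smX : smooth_on (img c) (xi c) := @field_smooth _ _ M xi c.
Let oD : open (utc_dom t) := @utc_dom_open _ _ M c t.
Let oW : open (utc_img t) := @utc_img_open _ _ M c t.
Let smP : smooth_on (utc_img t) P := @utc_par_smooth _ _ M c t.
Let smC : smooth_on (utc_dom t) (utc_coords t) := @utc_coords_smooth _ _ M c t.

Lemma lift_ptK v : lsubmx (L v) = v. Proof. exact: row_mxKl. Qed.

Lemma lift_pt_field v : rsubmx (L v) = xi c v. Proof. exact: row_mxKr. Qed.

Lemma differentiable_lift_pt v : img c v -> differentiable L v.
Proof.
move=> Ov; apply: (@differentiable_row_mx _ _ _ _ id) => //.
exact: (smooth_differentiable oO smX).
Qed.

Lemma derive_lift_pt v x : img c v -> 'D_x L v = row_mx x ('D_x (xi c) v).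
Proof.
move=> Ov; have dx := smooth_differentiable oO smX Ov.
have did : differentiable (id : 'rV[R]_n.+1 -> _) v by [].
by apply: etrans (derive_row_mx x did dx) _; rewrite derive_id.
Qed.

Lemma lift_pt_near : \forall v \near u, img c v /\ utc_dom t (L v).
Proof.
have cL : {for u, continuous L}.
  exact/differentiable_continuous/differentiable_lift_pt.
by apply: filterS2 (open_near oO Ou) (cL _ (open_near oD tu)).
Qed.

Lemma lift_pt_dom v : img c v -> utc_dom t (L v) ->
  (utc_dom t `&` unit_tangent c) (L v).
Proof.
move=> Ov Dv; split=> //; split; rewrite lift_ptK// lift_pt_field.
exact: field_unit.
Qed.

(** The unit length of the field puts [L v] on T_1M, where [P] inverts the coordinates; [L v] is
    known to lie in the domain of [t] only near [u]. *)
Lemma ut_mapK : \forall v \near u, P (F v) = L v.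
Proof.
by apply: filterS lift_pt_near => v [Ov Dv]; exact/utc_coordsK/lift_pt_dom.
Qed.

Lemma ut_map_img : utc_img t (F u).
Proof. exact/utc_coords_img/lift_pt_dom. Qed.

Let Wu := ut_map_img.
Let PFu : P (F u) = L u := nbhs_singleton ut_mapK.

Lemma utc_par_base w : utc_img t w -> img c (lsubmx (P w)).
Proof. by move=> /utc_par_dom[_ []]. Qed.

Let OP : img c (lsubmx (P (F u))) := utc_par_base Wu.

Lemma ut_map_near_differentiable : \forall v \near u, differentiable F v.
Proof.
apply: filterS lift_pt_near => v [Ov Dv].
apply: (@differentiable_comp _ _ _ _ L); first exact: differentiable_lift_pt.
exact: (smooth_differentiable oD smC).
Qed.

Let dF : differentiable F u := nbhs_singleton ut_map_near_differentiable.

Lemma lift_pt_near_differentiable : \forall v \near u, differentiable L v.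
Proof.
by apply: filterS (open_near oO Ou) => v; exact: differentiable_lift_pt.
Qed.

Lemma derive_lift_pt_near x :
  \forall v \near u, row_mx x ('D_x (xi c) v) = 'D_x L v.
Proof.
by apply: filterS (open_near oO Ou) => v Ov; rewrite derive_lift_pt.
Qed.

Lemma differentiable_derive_lift_pt x : differentiable ('D_x L) u.
Proof.
apply: differentiable_near_eq (derive_lift_pt_near x) _.
apply: (@differentiable_row_mx _ _ _ _ (cst x)) => //.
exact: (smooth_derive_differentiable oO smX).
Qed.

Lemma derive2_lift_pt x : 'D_x ('D_x L) u = row_mx 0 ('D_x ('D_x (xi c)) u).
Proof.
apply: etrans (esym (near_eq_derive x (derive_lift_pt_near x))) _.
have dx : differentiable (cst x : 'rV[R]_n.+1 -> 'rV[R]_n.+1) u by [].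
have ddx := smooth_derive_differentiable oO smX x Ou.
by apply: etrans (derive_row_mx x dx ddx) _; rewrite derive_cst.
Qed.

Lemma differentiable_derive_ut_map x : differentiable ('D_x F) u.
Proof.
apply: (differentiable_derive_comp oD smC lift_pt_near_differentiable tu).
exact: differentiable_derive_lift_pt.
Qed.

Lemma push_ut_map x : 'D_('D_x F u) P (F u) = 'D_x L u.
Proof.
apply: etrans (esym (derive_chain x dF (smooth_differentiable oW smP Wu))) _.
exact: near_eq_derive ut_mapK.
Qed.

Lemma push_ut_map2 x :
  'D_('D_x ('D_x F) u) P (F u) + 'D_('D_x F u) ('D_('D_x F u) P) (F u)
  = 'D_x ('D_x L) u.
Proof.
apply: etrans (esym (derive2_comp oW smP ut_map_near_differentiable Wu
  (differentiable_derive_ut_map x))) _.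
(* To be differentiated twice, the identity P o F = L must hold around each point near [u]. *)
apply: near_eq_derive; apply: filterS (near_join ut_mapK) => v Ev.
exact: near_eq_derive.
Qed.

(** * The induced metric of T_1M and its Koszul formula *)

Lemma inprod_ut_gram w X Y : utc_img t w ->
  inprod (S (P w)) ('D_X P w) ('D_Y P w) = inprod (h w) X Y.
Proof.
move=> Ww; have dP := smooth_differentiable oW smP Ww.
rewrite (derive_dirE X dP) (derive_dirE Y dP) inprod_suml inprodE.
apply: eq_bigr => i _; rewrite inprod_sumr; apply: eq_bigr => j _.
by rewrite inprodZl inprodZr mxE -sasakiE.
Qed.

Lemma ut_gram_sym w : utc_img t w -> (h w)^T = h w.
Proof.
move=> Ww; apply/matrixP => i j; rewrite !mxE !sasakiE.
by apply: inprod_sym; apply: sasaki_mx_sym; apply: symG; exact: utc_par_base.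
Qed.

Lemma differentiable_sasaki_par w : utc_img t w -> differentiable (fun w => S (P w)) w.
Proof.
move=> Ww; apply: (@differentiable_comp _ _ _ _ P S).
  exact: (smooth_differentiable oW smP).
exact: (differentiable_sasaki_mx oO smG uG (utc_par_base Ww)).
Qed.

Lemma differentiable_ut_gram w : utc_img t w -> differentiable h w.
Proof.
move=> Ww; apply: differentiable_mx => i j.
rewrite (_ : (fun _ => _) = fun w => inprod (S (P w)) ('D_(bvec R i) P w)
    ('D_(bvec R j) P w)); last by apply/funext => v; rewrite mxE sasakiE.
apply: differentiable_inprod; first exact: differentiable_sasaki_par.
- exact: (smooth_derive_differentiable oW smP).
- exact: (smooth_derive_differentiable oW smP).
Qed.

(** The chain rule for [utc_coords] after [P], which is the identity on an open set. The resulting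
    injectivity of the differential of [P] gives both the nondegeneracy of [ut_gram] and the rank
    count in [normal_push]. *)
Lemma jacobian_parK : 'J P (F u) *m 'J (utc_coords t) (P (F u)) = 1%:M.
Proof.
have DP : utc_dom t (P (F u)) by rewrite PFu.
apply/row_matrixP => i; rewrite !rowE mulmxA mulmx1.
rewrite -(smooth_deriveEjacobian oW smP _ Wu) -(smooth_deriveEjacobian oD smC _ DP).
apply: etrans (esym (derive_chain _ (smooth_differentiable oW smP Wu)
   (smooth_differentiable oD smC DP))) _.
apply: etrans (derive_id (F u) _); apply: near_eq_derive.
by apply: filterS (open_near oW Wu) => w Ww; exact: utc_parK.
Qed.

Lemma ut_gram_unit : h (F u) \in unitmx.
Proof.
apply: inprod_pos_unit => X X0; rewrite -inprod_ut_gram// -sasakiE.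
apply: sasaki_pos => [Y Y0|]; first exact: gram_pos.
apply: contraNneq X0; rewrite (smooth_deriveEjacobian oW smP _ Wu) => E.
by rewrite -[X]mulmx1 -jacobian_parK mulmxA E mul0mx.
Qed.

Lemma derive_ut_gram V X Y : inprod ('D_V h (F u)) X Y =
  inprod ('D_('D_V P (F u)) S (L u)) ('D_X P (F u)) ('D_Y P (F u))
  + inprod (S (L u)) ('D_V ('D_X P) (F u)) ('D_Y P (F u))
  + inprod (S (L u)) ('D_X P (F u)) ('D_V ('D_Y P) (F u)).
Proof.
apply: etrans (esym (derive_inprod_cst X Y V (differentiable_ut_gram Wu))) _.
have E : \forall w \near F u, inprod (S (P w)) ('D_X P w) ('D_Y P w) =
    inprod (h w) X Y.
  by apply: filterS (open_near oW Wu) => w; exact: inprod_ut_gram.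
apply: etrans (esym (near_eq_derive V E)) _.
have dSP := differentiable_sasaki_par Wu.
have ddX := smooth_derive_differentiable oW smP X Wu.
have ddY := smooth_derive_differentiable oW smP Y Wu.
apply: etrans (derive_inprod V dSP ddX ddY) _.
have dP := smooth_differentiable oW smP Wu.
have dS := differentiable_sasaki_mx oO smG uG OP.
have EC := derive_chain V dP dS.
by rewrite EC PFu.
Qed.

Lemma koszul_ut_gram X nu :
  inprod (h (F u)) (Gamma h (F u) X X) nu =
  inprod (S (L u)) ('D_X ('D_X P) (F u)) ('D_nu P (F u))
  + (inprod ('D_('D_X P (F u)) S (L u)) ('D_X P (F u)) ('D_nu P (F u))
     - 2^-1 * inprod ('D_('D_nu P (F u)) S (L u)) ('D_X P (F u)) ('D_X P (F u))).
Proof.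
(* Here [p] and [q] are derivatives of [h], and the [s] and [t] are their product rule terms.
   [t3 = s3] is the symmetry of the second derivatives of [P], [t2 = t3] that of [S]; together they
   cancel every second derivative except [s2]. *)
have solve (k p q s1 s2 s3 t1 t2 t3 : R) : 2 * k = p + p - q ->
  p = s1 + s2 + s3 -> q = t1 + t2 + t3 -> t3 = s3 -> t2 = t3 ->
  k = s2 + (s1 - 2^-1 * t1) by lra.
have symh : \forall w \near F u, (h w)^T = h w.
  by apply: filterS (open_near oW Wu) => w; exact: ut_gram_sym.
have K := koszul (differentiable_ut_gram Wu) symh ut_gram_unit X X nu.
have sS : (S (L u))^T = S (L u).
  by apply: sasaki_mx_sym; rewrite lift_ptK; exact: symG.
have E1 := derive_ut_gram X X nu; have E2 := derive_ut_gram nu X X.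
have E3 := congr1 (inprod (S (L u)) ('D_X P (F u)))
  (smooth_derive_comm oW smP nu X Wu).
have E4 := inprod_sym ('D_nu ('D_X P) (F u)) ('D_X P (F u)) sS.
exact: solve K E1 E2 E3 E4.
Qed.

(* The chart of T_1M disappears: only the Sasaki metric of TM remains. *)
Lemma second_form_sasaki x nu : second_form xi t u ('D_nu P (F u)) x x =
  inprod (S (L u)) ('D_x ('D_x L) u) ('D_nu P (F u))
  + (inprod ('D_('D_x L u) S (L u)) ('D_x L u) ('D_nu P (F u))
     - 2^-1 * inprod ('D_('D_nu P (F u)) S (L u)) ('D_x L u) ('D_x L u)).
Proof.
have dP := smooth_differentiable oW smP Wu.
have K a : 'D_('D_x F u) P (F u) = a ->
    inprod (h (F u)) (Gamma h (F u) ('D_x F u) ('D_x F u)) nu =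
    inprod (S (L u)) ('D_('D_x F u) ('D_('D_x F u) P) (F u)) ('D_nu P (F u))
    + (inprod ('D_a S (L u)) a ('D_nu P (F u))
       - 2^-1 * inprod ('D_('D_nu P (F u)) S (L u)) a a).
  by move=> <-; exact: koszul_ut_gram.
have H := inprod_ut_gram (Gamma h (F u) ('D_x F u) ('D_x F u)) nu Wu.
rewrite PFu in H.
have lP a b : 'D_(a + b) P (F u) = 'D_a P (F u) + 'D_b P (F u).
  by have := derive_linear 1 a b dP; rewrite !scale1r.
rewrite /second_form /covd_along sasakiE.
apply: etrans (congr1 (fun v => inprod (S (L u)) v _) (lP _ _)) _.
apply: etrans (inprodDl _ _ _ _) _.
apply: etrans (congr2 +%R (erefl _) (etrans H (K _ (push_ut_map x)))) _.
rewrite addrA; congr (_ + _); apply: etrans (esym (inprodDl _ _ _ _)) _.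
exact: (congr1 (fun v => inprod _ v _) (push_ut_map2 x)).
Qed.

(** The unit length condition is differentiated along [P]; metric compatibility turns the derivative
    of the squared length into twice this product. *)
Lemma conn_map_par_normal X :
  inprod (g u) (conn_map g (L u) ('D_X P (F u))) (xi c u) = 0.
Proof.
pose Q (z : 'rV[R]_(n.+1 + n.+1)) : R := inprod (g (lsubmx z)) (rsubmx z) (rsubmx z).
have dl := @differentiable_lsubmx R 1 n.+1 n.+1 (L u).
have dr := @differentiable_rsubmx R 1 n.+1 n.+1 (L u).
have Oz : img c (lsubmx (L u)) by rewrite lift_ptK.
have dgl := differentiable_gram_base oO smG Oz.
have dQ : differentiable Q (P (F u)) by rewrite PFu; exact: differentiable_inprod.
have dP := smooth_differentiable oW smP Wu.
have Q1 : \forall w \near F u, Q (P w) = cst 1 w.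
  by apply: filterS (open_near oW Wu) => w Ww; have [_ []] := utc_par_dom Ww.
have : 'D_('D_X P (F u)) Q (L u) = 0.
  rewrite -PFu; apply: etrans (esym (derive_chain X dP dQ)) _.
  by apply: etrans (near_eq_derive X Q1) _; rewrite derive_cst.
move: ('D_X P (F u)) => a D0.
have E1 := derive_inprod a dgl dr dr.
have E2 := derive_chain a dl (smooth_differentiable oO smG Oz).
rewrite derive_lsubmx in E2; rewrite E2 derive_rsubmx lift_ptK lift_pt_field in E1.
have sG : \forall v \near u, (g v)^T = g v by apply: filterS (open_near oO Ou).
have dGu := smooth_differentiable oO smG Ou.
rewrite (metric_compat dGu sG (uG Ou)) in E1.
have sGu := symG Ou.
rewrite (inprod_sym (xi c u) _ sGu) (inprod_sym (xi c u) (rsubmx a) sGu) in E1.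
move: (etrans (esym E1) D0).
rewrite /conn_map lift_ptK lift_pt_field (Gamma_sym dGu sG (xi c u)) inprodDl.
by move: (inprod _ (rsubmx a) _) (inprod _ _ _) => p q {E1 D0}; lra.
Qed.

Lemma normal_push N : inprod (g u) (conn_map g (L u) N) (xi c u) = 0 ->
  exists nu, N = 'D_nu P (F u).
Proof.
move=> N0; pose J := 'J P (F u).
pose f a : R := inprod (g u) (conn_map g (L u) a) (xi c u).
(* The functional [f] as a column: its kernel becomes [kermx q], comparable by rank with the row
   space of [J]. *)
pose q : 'cV[R]_(n.+1 + n.+1) := \col_i f (bvec R i).
have lf : linear (f : _ -> R^o).
  by move=> k a b; rewrite /f conn_map_linear inprodDl inprodZl.
have fq a : a *m q = (f a)%:M.
  apply/matrixP => i j; rewrite !ord1 !mxE eqxx mulr1n (linear_rowE a lf).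
  by apply: eq_bigr => k _; rewrite mxE.
have Jq : J *m q = 0.
  apply/row_matrixP => i; rewrite row0 row_mul fq rowE.
  rewrite -(smooth_deriveEjacobian oW smP _ Wu) [f _]conn_map_par_normal.
  by rewrite raddf0.
(* On the vertical lift of the unit field, [f] takes the value 1. *)
have q0 : q != 0.
  apply/eqP => q0; have := fq (vlift (L u) (xi c u)).
  rewrite q0 mulmx0 /f (vliftE g (L u) (xi c u)).2 field_unit// => /matrixP/(_ 0 0).
  by rewrite !mxE eqxx mulr1n => /eqP; rewrite eq_sym oner_eq0.
have rJ : row_free J.
  apply/row_freeP; exists ('J (utc_coords t) (P (F u))); exact: jacobian_parK.
have rq : \rank q = 1%N.
  by apply/eqP; rewrite eqn_leq rank_leq_col lt0n mxrank_eq0.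
have JK : (J <= kermx q)%MS by apply/sub_kermxP.
have KJ : (kermx q <= J)%MS.
  rewrite -(mxrank_leqif_sup JK) mxrank_ker rq (eqP rJ).
  by rewrite addnS subn1 /= addSn.
have : (N <= J)%MS.
  by apply: submx_trans KJ; apply/sub_kermxP; rewrite fq [f N]N0 raddf0.
case/submxP => nu ->; exists nu.
by rewrite (smooth_deriveEjacobian oW smP _ Wu).
Qed.

(** * Bilinearity of the second fundamental form *)

Let scalerD_ACA (V : lmodType R) (k : R) (p q r s : V) :
  k *: p + q + (k *: r + s) = k *: (p + r) + (q + s).
Proof. by rewrite scalerDr addrACA. Qed.

Let W x y := covd_along h F x (fun v => 'D_y F v) u.

Let W_linearl k x x' y : W (k *: x + x') y = k *: W x y + W x' y.
Proof.
rewrite /W /covd_along (derive_linear k x x' dF) GammaDl GammaZl.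
have E := derive_linear k x x' (differentiable_derive_ut_map y).
apply: etrans (congr1 (+%R^~ _) E) _.
exact: scalerD_ACA.
Qed.

Let W_linearr k x y y' : W x (k *: y + y') = k *: W x y + W x y'.
Proof.
rewrite /W /covd_along (derive_linear k y y' dF) GammaDr GammaZr.
(* ['D_y F] is differentiated again along [x], so its linearity in [y] is required on a whole
   neighbourhood. *)
have E : \forall v \near u, (k *: 'D_y F + 'D_y' F) v = 'D_(k *: y + y') F v.
  apply: filterS ut_map_near_differentiable => v dv.
  by rewrite (derive_linear k y y' dv).
have d1 := diff_derivable (v := x) (differentiable_derive_ut_map y).
have d2 := diff_derivable (v := x) (differentiable_derive_ut_map y').
have E2 : 'D_x ('D_(k *: y + y') F) u = k *: 'D_x ('D_y F) u + 'D_x ('D_y' F) u.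
  apply: etrans (esym (near_eq_derive x E)) _.
  apply: etrans (deriveD (derivableZ d1) d2) _.
  by apply: (congr2 +%R) => //; exact: deriveZ.
apply: etrans (congr1 (+%R^~ _) E2) _.
exact: scalerD_ACA.
Qed.

(** Bilinearity transfers the trace in [mean_curv], taken in the coordinate basis, to an adapted
    frame. *)
Lemma second_form_linearl N y : linear (fun x => second_form xi t u N x y : R^o).
Proof.
move=> k x x'.
have E := derive_linear k (W x y) (W x' y) (smooth_differentiable oW smP Wu).
have E2 := @sasaki_linearl _ _ g (L u) N k ('D_(W x y) P (F u)) ('D_(W x' y) P (F u)).
apply: etrans _ E2; apply: (congr1 (fun v => sasaki g (L u) v N)).
by apply: etrans E; exact: (congr1 (derive P (F u)) (W_linearl k x x' y)).
Qed.

Lemma second_form_linearr N x : linear (fun y => second_form xi t u N x y : R^o).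
Proof.
move=> k y y'.
have E := derive_linear k (W x y) (W x y') (smooth_differentiable oW smP Wu).
have E2 := @sasaki_linearl _ _ g (L u) N k ('D_(W x y) P (F u)) ('D_(W x y') P (F u)).
apply: etrans _ E2; apply: (congr1 (fun v => sasaki g (L u) v N)).
by apply: etrans E; exact: (congr1 (derive P (F u)) (W_linearr k x y y')).
Qed.

(** * The second fundamental form on normal vectors and its trace *)

Local Notation dxi := (nabla g (xi c) u).

Let sG : \forall v \near u, (g v)^T = g v.
Proof. by apply: filterS (open_near oO Ou). Qed.

Let dGu : differentiable g u := smooth_differentiable oO smG Ou.

Lemma conn_map_lift_pt x : conn_map g (L u) ('D_x L u) = dxi x.
Proof.
rewrite (derive_lift_pt x Ou) /conn_map lift_ptK lift_pt_field row_mxKl row_mxKr.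
by rewrite (Gamma_sym dGu sG).
Qed.

Lemma sasaki_lift_pt x y : sasaki g (L u) ('D_x L u) y =
  inprod (g u) x (lsubmx y) + inprod (g u) (dxi x) (conn_map g (L u) y).
Proof.
by rewrite /sasaki conn_map_lift_pt lift_ptK (derive_lift_pt x Ou) row_mxKl.
Qed.

Lemma inprod_sub_gram x y : inprod (sub_gram xi t u) x y =
  inprod (g u) x y + inprod (g u) (dxi x) (dxi y).
Proof.
have <- : sasaki g (L u) ('D_x L u) ('D_y L u) =
    inprod (g u) x y + inprod (g u) (dxi x) (dxi y).
  by rewrite sasaki_lift_pt conn_map_lift_pt (derive_lift_pt y Ou) row_mxKl.
have dL := differentiable_lift_pt Ou.
rewrite sasakiE (derive_dirE x dL) (derive_dirE y dL) inprod_suml inprodE.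
apply: eq_bigr => i _; rewrite inprod_sumr; apply: eq_bigr => j _.
rewrite inprodZl inprodZr; congr (_ * (_ * _)); rewrite mxE.
have E := inprod_ut_gram ('D_(bvec R i) F u) ('D_(bvec R j) F u) Wu.
apply: etrans (esym E) _.
by apply: etrans (congr2 (inprod _) (push_ut_map _) (push_ut_map _)) _; rewrite PFu.
Qed.

(** The first hypothesis makes [N] tangent to T_1M, the second orthogonal to each ['D_y L u].
    Diagonal values determine the trace in an orthogonal frame. *)
Lemma second_form_normal N x :
  inprod (g u) (conn_map g (L u) N) (xi c u) = 0 ->
  (forall y, inprod (g u) y (lsubmx N) + inprod (g u) (dxi y) (conn_map g (L u) N) = 0) ->
  second_form xi t u N x x =
  inprod (g u) (rten g (xi c) u x x) (conn_map g (L u) N)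
  + inprod (g u) (dxi x) (Riem g (xi c) u x (lsubmx N)).
Proof.
move=> N1 N2; have [nu Enu] := normal_push N1.
have E := second_form_sasaki x nu; rewrite -Enu in E.
apply: etrans E _.
have Oz : img c (lsubmx (L u)) by rewrite lift_ptK.
have K := sasaki_koszul oO smG symG uG ('D_x L u) N Oz.
apply: etrans (congr1 (+%R _) K) _.
have lx : lsubmx ('D_x L u) = x by rewrite (derive_lift_pt x Ou) row_mxKl.
have rx : rsubmx ('D_x L u) = 'D_x (xi c) u by rewrite (derive_lift_pt x Ou) row_mxKr.
have A : conn_map_covd g (L u) ('D_x L u) ('D_x L u) =
    Gamma g u x (dxi x) + (dGamma g u x (xi c u) x + Gamma g u ('D_x (xi c) u) x).
  rewrite /conn_map_covd /conn_map_deriv conn_map_lift_pt lx rx.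
  by rewrite lift_ptK lift_pt_field.
have B : inprod (S (L u)) ('D_x ('D_x L) u) N =
    inprod (g u) ('D_x ('D_x (xi c)) u) (conn_map g (L u) N).
  rewrite -sasakiE (derive2_lift_pt x) /sasaki (vliftE g (L u) _).2.
  by rewrite (vliftE g (L u) _).1 inprod0l add0r lift_ptK.
have C : Riem g (xi c) u x (lsubmx N) = curv g u (xi c u) x (lsubmx N).
  exact: (Riem_curv oO smG symG uG smX Ou).
rewrite conn_map_lift_pt lx lift_ptK lift_pt_field -C in A B *.
rewrite A B.
(* The second derivative of the lift and the covariant derivative of the connection map add up to
   [rten], except for [dxi] of the vector [Gamma g u x x]. *)
have D : 'D_x ('D_x (xi c)) u + (Gamma g u x (dxi x)
    + (dGamma g u x (xi c u) x + Gamma g u ('D_x (xi c) u) x)) =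
    rten g (xi c) u x x + dxi (Gamma g u x x).
  rewrite (rtenE oO smG uG smX Ou) subrK.
  rewrite (dGamma_sym oO smG symG uG x (xi c u) x Ou).
  rewrite (Gamma_sym dGu sG ('D_x (xi c) u) x).
  have -> : dxi x = 'D_x (xi c) u + Gamma g u x (xi c u) by [].
  rewrite GammaDr.
  move: ('D_x ('D_x (xi c)) u) (Gamma g u x ('D_x (xi c) u)) => p q.
  move: (dGamma _ _ _ _ _) (Gamma _ _ x _) => r s.
  by apply/rowP => i; rewrite !mxE; ring.
(* This excess and the horizontal term of [sasaki_koszul] form the product of [N] with the
   derivative of [L] along [Gamma g u x x], which is zero. *)
have H := N2 (Gamma g u x x).
have E := congr1 (fun v => inprod (g u) v (conn_map g (L u) N)) D.
rewrite [LHS]inprodDl [RHS]inprodDl in E.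
move: E H.
move: (inprod _ (Gamma g u x x) _) (inprod _ (dxi (Gamma g u x x)) _) => p q.
move: (inprod _ (rten _ _ _ _ _) _) (inprod _ (dxi x) _) => r s.
move: (inprod _ _ _) (inprod _ _ _) => v w {A B C D K Enu N2} E H.
by lra.
Qed.

Lemma mean_curv_frame N (e : 'I_n.+1 -> 'rV[R]_n.+1) (d : 'I_n.+1 -> R) :
  (forall i j, inprod (sub_gram xi t u) (e i) (e j) = d i * (i == j)%:R) ->
  (forall i, d i != 0) ->
  n.+1%:R * mean_curv xi t u N = \sum_i second_form xi t u N (e i) (e i) / d i.
Proof.
move=> He d0; rewrite /mean_curv mulrA mulfV ?pnatr_eq0// mul1r.
rewrite (trace_frame _ He d0); apply: eq_bigr => i _; congr (_ / _).
apply/esym/bilinear_inprodE => v.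
- exact: second_form_linearr.
- exact: second_form_linearl.
Qed.

End UnitTangentChart.

(** * The mean curvature *)

Theorem theorem2p5 (R : realType) (n : nat) (M : riemannian R n.+1)
    (xi : unit_field M) (Q : M) (c : chart M) (hQ : dom c Q)
    (t : unit_tangent_chart c)
    (ht : utc_dom t (lift_pt xi c (coords c Q)))
    (e : 'I_n.+1 -> 'rV[R]_n.+1) (f : 'I_n -> 'rV[R]_n.+1)
    (lambda : 'I_n -> R)
    (nabla_adj : 'rV[R]_n.+1 -> 'rV[R]_n.+1) :
  let u := coords c Q in
  let g := gram c in
  let e_ (alpha : 'I_n) := e (lift ord0 alpha) in
  let Dxi := nabla g (xi c) u in
  let r := rten g (xi c) u in
  let Rm := Riem g (xi c) u in
  (forall X Y, inprod (g u) X (xi c u) = 0 ->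
     inprod (g u) (nabla_adj X) Y = inprod (g u) X (Dxi Y)) ->
  orthonormal_frame (g u) e ->
  orthonormal_frame (g u) f ->
  (forall alpha, inprod (g u) (f alpha) (xi c u) = 0) ->
  (forall alpha, 0 <= lambda alpha) ->
  Dxi (e ord0) = 0 ->
  (forall alpha, Dxi (e_ alpha) = lambda alpha *: f alpha) ->
  (forall alpha, nabla_adj (f alpha) = lambda alpha *: e_ alpha) ->
  let ntilde (sigma : 'I_n) :=
    (Num.sqrt (1 + lambda sigma ^+ 2))^-1 *:
      (- lambda sigma *: hlift g (lift_pt xi c u) (e_ sigma)
       + vlift (lift_pt xi c u) (f sigma)) in
  let H (sigma : 'I_n) := mean_curv xi t u (ntilde sigma) in
  forall sigma : 'I_n,
    n.+1%:R * H sigma =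
    (Num.sqrt (1 + lambda sigma ^+ 2))^-1 *
      (inprod (g u) (r (e ord0) (e ord0)) (f sigma) +
       \sum_(alpha < n)
         (inprod (g u) (r (e_ alpha) (e_ alpha)) (f sigma) +
          lambda sigma * lambda alpha *
            inprod (g u) (Rm (e_ sigma) (e_ alpha)) (f alpha))
         / (1 + lambda alpha ^+ 2)).
Proof.
move=> u g e_ Dxi r Rm adj oe of_ fxi l0 De0 De Df ntilde H sigma.
have Ou : img c u by exists Q.
set k := (Num.sqrt (1 + lambda sigma ^+ 2))^-1.
pose d (i : 'I_n.+1) := oapp (fun a => 1 + lambda a ^+ 2) 1 (unlift ord0 i).
have d0 : d ord0 = 1 by rewrite /d unlift_none.
have dS a : d (lift ord0 a) = 1 + lambda a ^+ 2 by rewrite /d liftK.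
have dn0 i : d i != 0.
  case: (unliftP ord0 i) => [a|] ->; rewrite ?d0 ?oner_eq0//.
  by rewrite dS gt_eqF// ltr_wpDr ?sqr_ge0.
(* The images of the frame under [Dxi] are 0 and multiples of the orthonormal [f], so the second
   summand of the induced metric is diagonal as well. *)
have gram_frame i j : inprod (sub_gram xi t u) (e i) (e j) = d i * (i == j)%:R.
  rewrite (inprod_sub_gram Ou ht) oe -/g -/Dxi.
  case: (unliftP ord0 i) => [a|] ->; last first.
    by rewrite De0 inprod0l addr0 d0 mul1r.
  case: (unliftP ord0 j) => [b|] ->; last first.
    by rewrite De0 inprod0r addr0 eq_sym (negbTE (neq_lift _ _)) mulr0.
  rewrite !De inprodZl inprodZr of_ (inj_eq lift_inj) dS.
  by case: eqVneq => [->|_]; rewrite ?mulr1 ?mulr0 ?addr0// expr2.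
have lN : lsubmx (ntilde sigma) = (k * - lambda sigma) *: e_ sigma.
  rewrite /ntilde !linearZ linearD /= linearZ /= (hliftE g _ _).1 (vliftE g _ _).1.
  by rewrite addr0 scalerA.
have KN : conn_map g (lift_pt xi c u) (ntilde sigma) = k *: f sigma.
  rewrite /ntilde -/k -[k *: _]addr0 conn_map_linear.
  rewrite conn_map_linear (hliftE g _ _).2 (vliftE g _ _).2 scaler0 add0r.
  by rewrite /conn_map !linear0 Gamma0r !addr0.
have N1 : inprod (g u) (conn_map g (lift_pt xi c u) (ntilde sigma)) (xi c u) = 0.
  by rewrite KN inprodZl fxi mulr0.
have sg : (g u)^T = g u by exact: gram_sym.
(* By the adjoint relation the vertical part contributes [lambda sigma] times the product of [y]
   with [e_ sigma], which cancels the horizontal part. *)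
have N2 y : inprod (g u) y (lsubmx (ntilde sigma)) +
    inprod (g u) (Dxi y) (conn_map g (lift_pt xi c u) (ntilde sigma)) = 0.
  rewrite lN KN !inprodZr (inprod_sym y _ sg) (inprod_sym (Dxi y) _ sg).
  by rewrite -adj// Df inprodZl; ring.
rewrite /H (mean_curv_frame Ou ht _ gram_frame dn0).
have SF x : second_form xi t u (ntilde sigma) x x =
    inprod (g u) (r x x) (k *: f sigma)
    + inprod (g u) (Dxi x) (Rm x ((k * - lambda sigma) *: e_ sigma)).
  by rewrite -KN -lN; exact: second_form_normal.
have RmZ a x y : Rm x (a *: y) = a *: Rm x y.
  exact: (RiemZr (@img_open _ _ M c) (@gram_smooth _ _ M c) (@gram_sym _ _ M c)
    (@gram_unit _ _ M c) (@field_smooth _ _ M xi c) Ou).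
(* The second form yields R(e_alpha, e_sigma) with the factor [- lambda sigma]; antisymmetry absorbs
   the sign. *)
have RmN x y : Rm x y = - Rm y x by exact: esym (opprB _ _).
under eq_bigr => i _ do rewrite SF.
(* At [ord0] the weight is 1, and [Dxi (e ord0) = 0] removes the curvature term. *)
rewrite big_ord_recl d0 divr1 De0 inprod0l addr0 inprodZr mulrDr.
congr (_ + _); rewrite mulr_sumr; apply: eq_bigr => a _.
rewrite dS De RmZ (RmN (e _)) (inprodZl _ (lambda a)) !inprodZr [RHS]mulrA.
rewrite inprodNr (inprod_sym (f a) _ sg); congr (_ / _).
move: (inprod _ (r _ _) _) (inprod _ (Rm _ _) _) => p q.
by ring.
Qed.
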